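(* A function $\phi:\mathbb{Z}\to\mathbb{H}$ is positive definite if and only if there exists a (not necessarily unique) nonnegative finite Radon measure $\mu$ on $\mathbb{S}$ such that $$\phi(n)=\int_{\mathbb{S}} s^n\,d\mu(s)\quad\text{for all } n\in\mathbb{Z}.$$
   Context: $\mathbb{H}$ is the real quaternion algebra and $\mathbb{S}=\{q\in\mathbb{H}:|q|=1\}$, the unit 3-sphere, with its usual topology. A function $\phi:\mathbb{Z}\to\mathbb{H}$ is positive definite if for all $k$, $n_1,\dots,n_k\in\mathbb{Z}$ and $q_1,\dots,q_k\in\mathbb{H}$, $\sum_{i,j=1}^k\overline{q_i}\,\phi(n_j-n_i)\,q_j$ is a nonnegative real number. The integral of the $\mathbb{H}$-valued continuous function $s\mapsto s^n$ is taken componentwise. *)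

(* Defs.v *)
(* Real quaternions H over an abstract R : realType,
   represented as R * R * R * R = (a, b, c, d) <-> a + b i + c j + d k,
   with the product Borel sigma-algebra (= Borel sets of R^4). *)
From mathcomp Require Import all_boot all_order all_algebra.
From mathcomp Require Import all_classical all_reals all_analysis.
Set Implicit Arguments. Unset Strict Implicit. Unset Printing Implicit Defensive.
Import Order.TTheory GRing.Theory Num.Theory.
Local Open Scope classical_set_scope.
Local Open Scope ring_scope.

Section Quat.
Variable R : realType.

Definition quat : Type := (R * R * R * R)%type.
Definition mkq (a b c d : R) : quat := (a, b, c, d).
Definition qre (q : quat) : R := q.1.1.1.
Definition qi (q : quat) : R := q.1.1.2.
Definition qj (q : quat) : R := q.1.2.
Definition qk (q : quat) : R := q.2.

Definition qzero : quat := mkq 0 0 0 0.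
Definition qone : quat := mkq 1 0 0 0.
Definition qadd (p q : quat) : quat :=
  mkq (qre p + qre q) (qi p + qi q) (qj p + qj q) (qk p + qk q).
(* Hamilton product: i^2 = j^2 = k^2 = ijk = -1 *)
Definition qmul (p q : quat) : quat :=
  mkq (qre p * qre q - qi p * qi q - qj p * qj q - qk p * qk q)
      (qre p * qi q + qi p * qre q + qj p * qk q - qk p * qj q)
      (qre p * qj q - qi p * qk q + qj p * qre q + qk p * qi q)
      (qre p * qk q + qi p * qj q - qj p * qi q + qk p * qre q).
Definition qconj (q : quat) : quat := mkq (qre q) (- qi q) (- qj q) (- qk q).
Definition qnorm2 (q : quat) : R := qre q ^+ 2 + qi q ^+ 2 + qj q ^+ 2 + qk q ^+ 2.
Definition qscale (r : R) (q : quat) : quat := mkq (r * qre q) (r * qi q) (r * qj q) (r * qk q).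
Definition qinv (q : quat) : quat := qscale (qnorm2 q)^-1 (qconj q).

Definition qpown (q : quat) (n : nat) : quat := iter n (qmul q) qone.
Definition qpow (q : quat) (n : int) : quat :=
  match n with
  | Posz m => qpown q m
  | Negz m => qpown (qinv q) m.+1
  end.

Definition qsphere : set quat := [set q | qnorm2 q = 1].

Definition qnonneg_real (q : quat) : Prop :=
  qi q = 0 /\ qj q = 0 /\ qk q = 0 /\ 0 <= qre q.

Definition qsum (k : nat) (F : 'I_k -> quat) : quat := \big[qadd/qzero]_(i < k) F i.

Definition qpos_def (phi : int -> quat) : Prop :=
  forall (k : nat) (ns : 'I_k -> int) (qs : 'I_k -> quat),
    qnonneg_real (qsum (fun i => qsum (fun j =>
      qmul (qmul (qconj (qs i)) (phi (ns j - ns i))) (qs j)))).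

Definition qint_pow (mu : {measure set quat -> \bar R}) (n : int) : quat :=
  mkq (Rintegral mu qsphere (fun s => qre (qpow s n)))
      (Rintegral mu qsphere (fun s => qi (qpow s n)))
      (Rintegral mu qsphere (fun s => qj (qpow s n)))
      (Rintegral mu qsphere (fun s => qk (qpow s n))).
End Quat.

(* Main.v *)
(** Write a point of the sphere as [s = cos t + sin t u] with [u] a unit imaginary
    quaternion, so that [s^n = cos nt + sin nt u]. Testing positive definiteness on
    [q_j = s^-j], [j < N], shows that the Fejer-type sum
    [Re (sum_(p, q < N) phi(q - p) s^(p - q)) = A(t) + B(t) . u] is nonnegative for
    all [u], i.e. [|B(t)| <= A(t)]. Hence at each of the [2N] angles [t = l pi / N] the
    pair [(A, B)] is carried by two atoms [cos t +- sin t u], and discrete Fourier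
    orthogonality turns the sum of these atoms into a positive measure whose [n]-th
    moment is [(1 - n / N) phi(n)].

    The weak limit is taken along an ultrafilter, which only yields a positive linear
    functional on bounded functions. Points of the sphere being coded by binary digits,
    this functional gives a mass to every finite word; laying the words out
    lexicographically as nested subintervals of [[0, phi(0))] defines a random bit stream
    whose law realises the functional on (uniformly) continuous functions. *)
Require Import Defs.
From mathcomp Require Import all_boot all_order all_algebra.
From mathcomp Require Import all_classical all_reals all_analysis.
From mathcomp Require Import measurable_realfun zify ring lra.
Import Order.TTheory GRing.Theory Num.Theory.
Import numFieldNormedType.Exports.
Local Open Scope classical_set_scope.
Local Open Scope ring_scope.

Set Implicit Arguments.
Unset Strict Implicit.

(** * Quaternions *)

Section QuatAlgebra.
Context {R : realType}.
Implicit Types p q r s : quat R.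

Lemma quatP p q : qre p = qre q -> qi p = qi q -> qj p = qj q -> qk p = qk q ->
  p = q.
Proof.
by case: p => [[[a b] c] d]; case: q => [[[a' b'] c'] d'];
  rewrite /qre /qi /qj /qk /= => -> -> -> ->.
Qed.

Lemma qmulA p q r : qmul p (qmul q r) = qmul (qmul p q) r.
Proof. by apply: quatP; rewrite /qmul /qre /qi /qj /qk /mkq /=; ring. Qed.

Lemma qmul1q q : qmul (qone R) q = q.
Proof. by apply: quatP; rewrite /qmul /qre /qi /qj /qk /mkq /=; ring. Qed.

Lemma qmulq1 q : qmul q (qone R) = q.
Proof. by apply: quatP; rewrite /qmul /qre /qi /qj /qk /mkq /=; ring. Qed.

Lemma qconj1 : qconj (qone R) = qone R.
Proof. by rewrite /qconj /qone /mkq /qre /qi /qj /qk /= oppr0. Qed.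

Lemma qconjK q : qconj (qconj q) = q.
Proof. by apply: quatP; rewrite /qconj /qre /qi /qj /qk /mkq /=; ring. Qed.

Lemma qconjM p q : qconj (qmul p q) = qmul (qconj q) (qconj p).
Proof. by apply: quatP; rewrite /qconj /qmul /qre /qi /qj /qk /mkq /=; ring. Qed.

Lemma qnorm2M p q : qnorm2 (qmul p q) = qnorm2 p * qnorm2 q.
Proof. by rewrite /qnorm2 /qmul /qre /qi /qj /qk /mkq /=; ring. Qed.

Lemma qnorm2_conj q : qnorm2 (qconj q) = qnorm2 q.
Proof. by rewrite /qnorm2 /qconj /qre /qi /qj /qk /mkq /=; ring. Qed.

Lemma qmul_conjl q : qmul (qconj q) q = mkq (qnorm2 q) 0 0 0.
Proof. by apply: quatP; rewrite /qnorm2 /qconj /qmul /qre /qi /qj /qk /mkq /=; ring. Qed.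

Lemma qmul_conjr q : qmul q (qconj q) = mkq (qnorm2 q) 0 0 0.
Proof. by apply: quatP; rewrite /qnorm2 /qconj /qmul /qre /qi /qj /qk /mkq /=; ring. Qed.

Lemma qre_sum k (F : 'I_k -> quat R) : qre (qsum F) = \sum_(i < k) qre (F i).
Proof. exact: (big_morph (@qre R) (op2 := @qadd R)). Qed.
Lemma qi_sum k (F : 'I_k -> quat R) : qi (qsum F) = \sum_(i < k) qi (F i).
Proof. exact: (big_morph (@qi R) (op2 := @qadd R)). Qed.
Lemma qj_sum k (F : 'I_k -> quat R) : qj (qsum F) = \sum_(i < k) qj (F i).
Proof. exact: (big_morph (@qj R) (op2 := @qadd R)). Qed.
Lemma qk_sum k (F : 'I_k -> quat R) : qk (qsum F) = \sum_(i < k) qk (F i).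
Proof. exact: (big_morph (@qk R) (op2 := @qadd R)). Qed.

Lemma qmul_suml k (F : 'I_k -> quat R) q :
  qmul (qsum F) q = qsum (fun i => qmul (F i) q).
Proof.
apply: (big_morph (fun p => qmul p q)) => [x y|];
  by apply: quatP; rewrite /qadd /qzero /qmul /qre /qi /qj /qk /mkq /=; ring.
Qed.

Lemma qmul_sumr k (F : 'I_k -> quat R) q :
  qmul q (qsum F) = qsum (fun i => qmul q (F i)).
Proof.
apply: (big_morph (fun p => qmul q p)) => [x y|];
  by apply: quatP; rewrite /qadd /qzero /qmul /qre /qi /qj /qk /mkq /=; ring.
Qed.

Lemma qconj_sum k (F : 'I_k -> quat R) :
  qconj (qsum F) = qsum (fun i => qconj (F i)).
Proof.
apply: (big_morph (@qconj R)) => [x y|];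
  by apply: quatP; rewrite /qadd /qzero /qconj /qre /qi /qj /qk /mkq /=; ring.
Qed.

Lemma qinv_sphere s : qsphere s -> qinv s = qconj s.
Proof.
rewrite /qsphere /qinv /= => ->.
by apply: quatP; rewrite invr1 /qscale /qconj /qre /qi /qj /qk /mkq /= mul1r.
Qed.

Lemma qsphere_conj s : qsphere s -> qsphere (qconj s).
Proof. by rewrite /qsphere /= qnorm2_conj. Qed.

Lemma qmul_conjr_sphere s : qsphere s -> qmul s (qconj s) = qone R.
Proof. by move=> s1; rewrite qmul_conjr s1. Qed.

Lemma qmul_conjl_sphere s : qsphere s -> qmul (qconj s) s = qone R.
Proof. by move=> s1; rewrite qmul_conjl s1. Qed.

Lemma qpownS q n : qpown q n.+1 = qmul q (qpown q n).
Proof. by []. Qed.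

Lemma qpownSr q n : qpown q n.+1 = qmul (qpown q n) q.
Proof.
elim: n => [|n IH]; first by rewrite /qpown /= qmul1q qmulq1.
by rewrite qpownS {1}IH qmulA.
Qed.

Lemma qconj_pown q n : qconj (qpown q n) = qpown (qconj q) n.
Proof.
elim: n => [|n IH]; first exact: qconj1.
by rewrite qpownS qconjM IH qpownSr.
Qed.

Lemma qsphere_pown s n : qsphere s -> qsphere (qpown s n).
Proof.
move=> s1; elim: n => [|n IH].
  by rewrite /qsphere /qnorm2 /= /qpown /= /qre /qi /qj /qk /=; ring.
by change (qnorm2 (qmul s (qpown s n)) = 1); rewrite qnorm2M s1 IH mulr1.
Qed.

Lemma qpow_oppn s n : qsphere s -> qpow s (- Posz n) = qconj (qpown s n).
Proof.
move=> s1; case: n => [|n]; first by rewrite oppr0 /= qconj1.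
by rewrite -NegzE /qpow qinv_sphere// qconj_pown.
Qed.

Lemma qpow_succ s (n : int) : qsphere s -> qpow s (n + 1) = qmul s (qpow s n).
Proof.
move=> s1; case: n => n; first by rewrite -PoszD addn1.
rewrite NegzE qpow_oppn// qconj_pown qpownS qmulA qmul_conjr_sphere// qmul1q.
by rewrite -addn1 PoszD opprD subrK qpow_oppn// qconj_pown.
Qed.

Lemma qpow_pred s (n : int) :
  qsphere s -> qpow s (n - 1) = qmul (qconj s) (qpow s n).
Proof.
move=> s1; rewrite -[in RHS](subrK 1 n) qpow_succ// qmulA.
by rewrite qmul_conjl_sphere// qmul1q.
Qed.

(** Induction on [m] by unit steps in both directions. On the sphere the inverse is the conjugate,
    so a downward step is multiplication by [qconj s]. *)
Lemma qpowD s (m n : int) :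
  qsphere s -> qpow s (m + n) = qmul (qpow s m) (qpow s n).
Proof.
move=> s1; elim: m => [|m IH|m IH]; first by rewrite add0r /= qmul1q.
  have -> : Posz m.+1 = Posz m + 1 by rewrite -addn1 PoszD.
  by rewrite addrAC !qpow_succ// IH qmulA.
have -> : - Posz m.+1 = - Posz m - 1 by rewrite intS opprD addrC.
by rewrite addrAC !qpow_pred// IH qmulA.
Qed.

Lemma qpowN s (n : int) : qsphere s -> qpow s (- n) = qconj (qpow s n).
Proof.
move=> s1; case: n => n; first exact: qpow_oppn.
by rewrite NegzE opprK qpow_oppn// qconjK.
Qed.

Lemma qnonneg_real_conj_mul q : qnonneg_real (qmul (qconj q) q).
Proof.
rewrite qmul_conjl /qnonneg_real /mkq /qre /qi /qj /qk /=; do 3!split => //.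
by rewrite /qnorm2 !addr_ge0// sqr_ge0.
Qed.

Lemma qsphere_le1 s : qsphere s ->
  [/\ `|qre s| <= 1, `|qi s| <= 1, `|qj s| <= 1 & `|qk s| <= 1].
Proof.
rewrite /qsphere /qnorm2 /= => s1.
split; rewrite -(@ler_pXn2r _ 2)// ?nnegrE// real_normK ?num_real// expr1n;
  by move: (sqr_ge0 (qre s)) (sqr_ge0 (qi s)) (sqr_ge0 (qj s))
    (sqr_ge0 (qk s)) s1; lra.
Qed.

End QuatAlgebra.

(** * Integration over the sphere *)

Section QuatMeasurable.
Context {R : realType}.

Lemma measurable_qre : measurable_fun setT (@qre R).
Proof.
apply: (@measurableT_comp _ _ _ _ _ _ (@fst R R)) => //.
exact: (@measurableT_comp _ _ _ _ _ _ (@fst (R * R)%type R)).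
Qed.

Lemma measurable_qi : measurable_fun setT (@qi R).
Proof.
apply: (@measurableT_comp _ _ _ _ _ _ (@snd R R)) => //.
exact: (@measurableT_comp _ _ _ _ _ _ (@fst (R * R)%type R)).
Qed.

Lemma measurable_qj : measurable_fun setT (@qj R).
Proof. exact: (@measurableT_comp _ _ _ _ _ _ (@snd (R * R)%type R)). Qed.

Lemma measurable_qk : measurable_fun setT (@qk R).
Proof. exact: (@measurable_snd _ _ _ R). Qed.

(** Stated coordinate by coordinate, so that the closure properties of real measurable functions
    apply to the polynomial formulas of the quaternion operations. *)
Definition qmeasurable (G : quat R -> quat R) :=
  [/\ measurable_fun setT (@qre R \o G), measurable_fun setT (@qi R \o G),
      measurable_fun setT (@qj R \o G) & measurable_fun setT (@qk R \o G)].

Lemma qmeasurable_mul F G : qmeasurable F -> qmeasurable G ->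
  qmeasurable (fun s => qmul (F s) (G s)).
Proof.
move=> [F0 F1 F2 F3] [G0 G1 G2 G3]; split.
- apply: measurable_funB; last exact: measurable_funM.
  apply: measurable_funB; last exact: measurable_funM.
  by apply: measurable_funB; apply: measurable_funM.
- apply: measurable_funB; last exact: measurable_funM.
  apply: measurable_funD; last exact: measurable_funM.
  by apply: measurable_funD; apply: measurable_funM.
- apply: measurable_funD; last exact: measurable_funM.
  apply: measurable_funD; last exact: measurable_funM.
  by apply: measurable_funB; apply: measurable_funM.
- apply: measurable_funD; last exact: measurable_funM.
  apply: measurable_funB; last exact: measurable_funM.
  by apply: measurable_funD; apply: measurable_funM.
Qed.

Lemma qmeasurable_conj F : qmeasurable F ->
  qmeasurable (fun s => qconj (F s)).
Proof.
by move=> [F0 F1 F2 F3]; split; rewrite //; exact: measurable_funN.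
Qed.

Lemma qmeasurable_pown n : qmeasurable (fun s => qpown s n).
Proof.
elim: n => [|n IH].
  by split; exact: measurable_cst.
apply: qmeasurable_mul IH; split.
exact: measurable_qre. exact: measurable_qi. exact: measurable_qj.
exact: measurable_qk.
Qed.

Lemma measurable_qsphere : measurable (@qsphere R : set (R * R * R * R)%type).
Proof.
have m2 : measurable_fun setT (@qnorm2 R).
  rewrite /qnorm2; do ![apply: measurable_funD | apply: measurable_funX].
  exact: measurable_qre. exact: measurable_qi. exact: measurable_qj.
  exact: measurable_qk.
have -> : @qsphere R = @qnorm2 R @^-1` [set 1] by [].
by rewrite -[X in measurable X]setTI; apply: m2.
Qed.

Variable mu : {finite_measure set (quat R) -> \bar R}.
Local Notation S := (@qsphere R : set (R * R * R * R)%type).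
Implicit Types F G : quat R -> quat R.

Definition sphere_integrable (f : quat R -> R) := mu.-integrable S (EFin \o f).

Lemma sphere_integrable_bounded (f : quat R -> R) : measurable_fun setT f ->
  (forall s, S s -> `|f s| <= 1) -> sphere_integrable f.
Proof.
move=> mf f1; apply: measurable_bounded_integrable.
- exact: measurable_qsphere.
- by rewrite -ge0_fin_numE// fin_num_measure//; exact: measurable_qsphere.
- exact: measurable_funTS.
- by exists 1; split => // x x1 s Ss; exact: le_trans (f1 _ Ss) (ltW x1).
Qed.

Lemma sphere_integrableZ r (f : quat R -> R) :
  sphere_integrable f -> sphere_integrable (fun s => r * f s).
Proof. by move=> i; exact: (@integrableZl _ _ _ mu S measurable_qsphere r (EFin \o f)). Qed.

Lemma sphere_integrableD (f g : quat R -> R) : sphere_integrable f ->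
  sphere_integrable g -> sphere_integrable (fun s => f s + g s).
Proof.
move=> i j.
exact: (@integrableD _ _ _ mu S measurable_qsphere (EFin \o f) (EFin \o g)).
Qed.

(** Multiplication by a fixed quaternion, on either side, makes each coordinate a real linear
    combination of the four old coordinates; this covers all eight cases at once. *)
Lemma sphere_integrable_lin4 a b c d (f0 f1 f2 f3 : quat R -> R) :
  sphere_integrable f0 -> sphere_integrable f1 ->
  sphere_integrable f2 -> sphere_integrable f3 ->
  sphere_integrable (fun s => a * f0 s + b * f1 s + c * f2 s + d * f3 s).
Proof.
by move=> i0 i1 i2 i3; do 3?[apply: sphere_integrableD]; exact: sphere_integrableZ.
Qed.

Lemma Rintegral_lin4 a b c d (f0 f1 f2 f3 : quat R -> R) :
  sphere_integrable f0 -> sphere_integrable f1 ->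
  sphere_integrable f2 -> sphere_integrable f3 ->
  Rintegral mu S (fun s => a * f0 s + b * f1 s + c * f2 s + d * f3 s) =
  a * Rintegral mu S f0 + b * Rintegral mu S f1 +
  c * Rintegral mu S f2 + d * Rintegral mu S f3.
Proof.
move=> i0 i1 i2 i3; have mS : measurable S := measurable_qsphere.
by rewrite !RintegralD ?RintegralZl//; do 3?[apply: sphere_integrableD];
  exact: sphere_integrableZ.
Qed.

Definition qintegrable G :=
  [/\ sphere_integrable (@qre R \o G), sphere_integrable (@qi R \o G),
      sphere_integrable (@qj R \o G) & sphere_integrable (@qk R \o G)].

Definition qint G : quat R :=
  mkq (Rintegral mu S (@qre R \o G)) (Rintegral mu S (@qi R \o G))
      (Rintegral mu S (@qj R \o G)) (Rintegral mu S (@qk R \o G)).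

Lemma eq_sphere_integrable (f g : quat R -> R) : {in S, f =1 g} ->
  sphere_integrable f -> sphere_integrable g.
Proof.
move=> fg; apply: eq_integrable; first exact: measurable_qsphere.
by move=> s Ss; rewrite /= fg.
Qed.

Lemma eq_qint F G : {in S, F =1 G} -> qint F = qint G.
Proof.
by move=> FG; rewrite /qint; congr mkq; apply: eq_Rintegral => s Ss /=; rewrite FG.
Qed.

Lemma eq_qintegrable F G : {in S, F =1 G} -> qintegrable F -> qintegrable G.
Proof.
move=> FG [i0 i1 i2 i3]; split; [move: i0|move: i1|move: i2|move: i3];
  by apply: eq_sphere_integrable => s Ss /=; rewrite FG.
Qed.

Lemma qintegrable_mull p G : qintegrable G -> qintegrable (fun s => qmul p (G s)).
Proof.
move=> [i0 i1 i2 i3]; split; move: p => [[[a b] c] d].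
- have := sphere_integrable_lin4 a (- b) (- c) (- d) i0 i1 i2 i3.
  by apply: eq_sphere_integrable => s _; rewrite /qmul /qre /qi /qj /qk /=; ring.
- have := sphere_integrable_lin4 b a (- d) c i0 i1 i2 i3.
  by apply: eq_sphere_integrable => s _; rewrite /qmul /qre /qi /qj /qk /=; ring.
- have := sphere_integrable_lin4 c d a (- b) i0 i1 i2 i3.
  by apply: eq_sphere_integrable => s _; rewrite /qmul /qre /qi /qj /qk /=; ring.
- have := sphere_integrable_lin4 d (- c) b a i0 i1 i2 i3.
  by apply: eq_sphere_integrable => s _; rewrite /qmul /qre /qi /qj /qk /=; ring.
Qed.

Lemma qintegrable_mulr p G : qintegrable G -> qintegrable (fun s => qmul (G s) p).
Proof.
move=> [i0 i1 i2 i3]; split; move: p => [[[a b] c] d].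
- have := sphere_integrable_lin4 a (- b) (- c) (- d) i0 i1 i2 i3.
  by apply: eq_sphere_integrable => s _; rewrite /qmul /qre /qi /qj /qk /=; ring.
- have := sphere_integrable_lin4 b a d (- c) i0 i1 i2 i3.
  by apply: eq_sphere_integrable => s _; rewrite /qmul /qre /qi /qj /qk /=; ring.
- have := sphere_integrable_lin4 c (- d) a b i0 i1 i2 i3.
  by apply: eq_sphere_integrable => s _; rewrite /qmul /qre /qi /qj /qk /=; ring.
- have := sphere_integrable_lin4 d c (- b) a i0 i1 i2 i3.
  by apply: eq_sphere_integrable => s _; rewrite /qmul /qre /qi /qj /qk /=; ring.
Qed.

Lemma qint_mull p G : qintegrable G -> qint (fun s => qmul p (G s)) = qmul p (qint G).
Proof.
move=> [i0 i1 i2 i3]; move: p => [[[a b] c] d].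
have L e f g h := Rintegral_lin4 e f g h i0 i1 i2 i3.
have -> : qint G = mkq (Rintegral mu S (@qre R \o G)) (Rintegral mu S (@qi R \o G))
  (Rintegral mu S (@qj R \o G)) (Rintegral mu S (@qk R \o G)) by [].
(* The four integrals become variables, which [ring] can treat as atoms. *)
move: (Rintegral mu S (@qre R \o G)) (Rintegral mu S (@qi R \o G))
  (Rintegral mu S (@qj R \o G)) (Rintegral mu S (@qk R \o G)) L => I0 I1 I2 I3 L.
apply: quatP.
- apply: etrans (_ : a * I0 + (- b) * I1 + (- c) * I2 + (- d) * I3 = _).
    rewrite -L; apply: eq_Rintegral => s _.
    by rewrite /= /qmul /mkq /qre /qi /qj /qk /=; ring.
  by rewrite /qmul /mkq /qre /qi /qj /qk /=; ring.
- apply: etrans (_ : b * I0 + a * I1 + (- d) * I2 + c * I3 = _).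
    rewrite -L; apply: eq_Rintegral => s _.
    by rewrite /= /qmul /mkq /qre /qi /qj /qk /=; ring.
  by rewrite /qmul /mkq /qre /qi /qj /qk /=; ring.
- apply: etrans (_ : c * I0 + d * I1 + a * I2 + (- b) * I3 = _).
    rewrite -L; apply: eq_Rintegral => s _.
    by rewrite /= /qmul /mkq /qre /qi /qj /qk /=; ring.
  by rewrite /qmul /mkq /qre /qi /qj /qk /=; ring.
- apply: etrans (_ : d * I0 + (- c) * I1 + b * I2 + a * I3 = _).
    rewrite -L; apply: eq_Rintegral => s _.
    by rewrite /= /qmul /mkq /qre /qi /qj /qk /=; ring.
  by rewrite /qmul /mkq /qre /qi /qj /qk /=; ring.
Qed.

Lemma qint_mulr p G : qintegrable G -> qint (fun s => qmul (G s) p) = qmul (qint G) p.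
Proof.
move=> [i0 i1 i2 i3]; move: p => [[[a b] c] d].
have L e f g h := Rintegral_lin4 e f g h i0 i1 i2 i3.
have -> : qint G = mkq (Rintegral mu S (@qre R \o G)) (Rintegral mu S (@qi R \o G))
  (Rintegral mu S (@qj R \o G)) (Rintegral mu S (@qk R \o G)) by [].
move: (Rintegral mu S (@qre R \o G)) (Rintegral mu S (@qi R \o G))
  (Rintegral mu S (@qj R \o G)) (Rintegral mu S (@qk R \o G)) L => I0 I1 I2 I3 L.
apply: quatP.
- apply: etrans (_ : a * I0 + (- b) * I1 + (- c) * I2 + (- d) * I3 = _).
    rewrite -L; apply: eq_Rintegral => s _.
    by rewrite /= /qmul /mkq /qre /qi /qj /qk /=; ring.
  by rewrite /qmul /mkq /qre /qi /qj /qk /=; ring.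
- apply: etrans (_ : b * I0 + a * I1 + d * I2 + (- c) * I3 = _).
    rewrite -L; apply: eq_Rintegral => s _.
    by rewrite /= /qmul /mkq /qre /qi /qj /qk /=; ring.
  by rewrite /qmul /mkq /qre /qi /qj /qk /=; ring.
- apply: etrans (_ : c * I0 + (- d) * I1 + a * I2 + b * I3 = _).
    rewrite -L; apply: eq_Rintegral => s _.
    by rewrite /= /qmul /mkq /qre /qi /qj /qk /=; ring.
  by rewrite /qmul /mkq /qre /qi /qj /qk /=; ring.
- apply: etrans (_ : d * I0 + c * I1 + (- b) * I2 + a * I3 = _).
    rewrite -L; apply: eq_Rintegral => s _.
    by rewrite /= /qmul /mkq /qre /qi /qj /qk /=; ring.
  by rewrite /qmul /mkq /qre /qi /qj /qk /=; ring.
Qed.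

Lemma qintegrable_add F G : qintegrable F -> qintegrable G ->
  qintegrable (fun s => qadd (F s) (G s)).
Proof.
by move=> [? ? ? ?] [? ? ? ?]; split; exact: sphere_integrableD.
Qed.

Lemma qint_add F G : qintegrable F -> qintegrable G ->
  qint (fun s => qadd (F s) (G s)) = qadd (qint F) (qint G).
Proof.
have mS : measurable S := measurable_qsphere.
by move=> [? ? ? ?] [? ? ? ?]; rewrite /qint; congr mkq; exact: RintegralD.
Qed.

(** Both claims are proved in one induction, because additivity of the integral at each step uses
    integrability of the remaining sum. *)
Lemma qint_sum k (F : 'I_k -> quat R -> quat R) : (forall i, qintegrable (F i)) ->
  qintegrable (fun s => qsum (F ^~ s)) /\
  qint (fun s => qsum (F ^~ s)) = qsum (fun i => qint (F i)).
Proof.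
move=> iF; rewrite /qsum.
elim: (index_enum _) => [|i r [IH1 IH2]].
  split; last first.
    rewrite big_nil (@eq_qint _ (fun=> qzero R)) => [|s _]; last by rewrite big_nil.
    by rewrite /qint /qzero; congr mkq; rewrite Rintegral_cst ?mul0r//;
      exact: measurable_qsphere.
  apply: (@eq_qintegrable (fun=> qzero R)) => [s _|]; first by rewrite big_nil.
  by split; apply: sphere_integrable_bounded => [|s _];
    do ?[exact: measurable_cst|rewrite /= normr0].
rewrite big_cons -IH2 -qint_add//; split.
  apply: (@eq_qintegrable (fun s => qadd (F i s) (\big[@qadd R/qzero R]_(i <- r) F i s))).
    by move=> s _; rewrite big_cons.
  exact: qintegrable_add.
by apply: eq_qint => s _; rewrite big_cons.
Qed.

(** Powers keep the sphere stable, so their coordinates are bounded by 1 there. A negative power is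
    replaced by the conjugate of a positive one, which is polynomial and agrees with it on the
    sphere. *)
Lemma qintegrable_pow n : qintegrable (fun s => qpow s n).
Proof.
have H m : qmeasurable m -> (forall s, S s -> S (m s)) -> qintegrable m.
  move=> [? ? ? ?] mS; split; (apply: sphere_integrable_bounded; first by []) => s Ss;
    by case: (qsphere_le1 (mS _ Ss)).
case: n => n.
  by apply: H => [|s]; [exact: qmeasurable_pown|exact: qsphere_pown].
apply: (@eq_qintegrable (fun s => qconj (qpown s n.+1))) => [s|].
  by rewrite inE NegzE => Ss; rewrite qpow_oppn.
apply: H => [|s Ss]; first exact/qmeasurable_conj/qmeasurable_pown.
exact/qsphere_conj/qsphere_pown.
Qed.

(** Under the integral the quadratic form becomes [qmul (qconj (P s)) (P s)], where [P s] is the sum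
    of the [s^(n_j) q_j]; this is pointwise the real number [qnorm2 (P s)]. *)
Lemma qpos_def_int : qpos_def (qint_pow mu).
Proof.
move=> k ns qs.
pose F i j s := qmul (qmul (qconj (qs i)) (qpow s (ns j - ns i))) (qs j).
have iF i j : qintegrable (F i j).
  exact/qintegrable_mulr/qintegrable_mull/qintegrable_pow.
have -> : qsum (fun i => qsum (fun j =>
      qmul (qmul (qconj (qs i)) (qint_pow mu (ns j - ns i))) (qs j))) =
    qint (fun s => qsum (fun i => qsum (fun j => F i j s))).
  have iF2 i := proj1 (qint_sum (iF i)).
  rewrite (proj2 (qint_sum iF2)); apply: eq_bigr => i _.
  rewrite (proj2 (qint_sum (iF i))); apply: eq_bigr => j _.
  rewrite qint_mulr; last exact/qintegrable_mull/qintegrable_pow.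
  by rewrite qint_mull//; exact: qintegrable_pow.
pose P s := qsum (fun j => qmul (qpow s (ns j)) (qs j)).
have -> : qint (fun s => qsum (fun i => qsum (fun j => F i j s))) =
    qint (fun s => qmul (qconj (P s)) (P s)).
  apply: eq_qint => s; rewrite inE => Ss.
  rewrite /P qconj_sum qmul_suml; apply: eq_bigr => i _.
  rewrite qmul_sumr; apply: eq_bigr => j _.
  (* On the sphere [s^(n_j - n_i)] factors as [qconj (s^(n_i))] times [s^(n_j)]. *)
  rewrite /F addrC qpowD// qpowN// qconjM.
  by rewrite !qmulA.
rewrite /qnonneg_real /qint /qi /qj /qk /qre /mkq /=.
have e0 f : f =1 (fun=> 0) -> Rintegral mu S f = 0.
  move=> f0; rewrite (@eq_Rintegral _ _ _ _ _ (fun=> 0)) => [|s _]; last exact: f0.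
  by rewrite Rintegral_cst ?mul0r//; exact: measurable_qsphere.
split; [|split; [|split]].
- by apply: e0 => s; case: (qnonneg_real_conj_mul (P s)).
- by apply: e0 => s; case: (qnonneg_real_conj_mul (P s)) => _ [].
- by apply: e0 => s; case: (qnonneg_real_conj_mul (P s)) => _ [_ []].
- by apply: Rintegral_ge0 => s _; case: (qnonneg_real_conj_mul (P s)) => _ [_ []].
Qed.
End QuatMeasurable.

(** * Functions of bit streams *)

Section Bitstreams.
Context {R : realType}.
Implicit Types (g h : (nat -> bool) -> R) (s : seq bool) (z : nat -> bool).

Definition cylinder_continuous g := forall e : R, 0 < e -> exists k, forall z z',
  mkseq z k = mkseq z' k -> `|g z - g z'| <= e.

Definition extend s : nat -> bool := nth false s.

Lemma mkseq_extend s k : size s = k -> mkseq (extend s) k = s.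
Proof. by move=> <-; rewrite mkseq_nth. Qed.

(** Up to an error of 1, [g z] depends on a prefix of length [k], and there are finitely many of
    these; summing the absolute values over all of them dominates each one. *)
Lemma cylinder_continuous_bounded g : cylinder_continuous g ->
  exists2 M : R, 0 < M & forall z, `|g z| <= M.
Proof.
move=> /(_ 1 ltr01)[k gk].
exists (\sum_(s : k.-tuple bool) `|g (extend s)| + 1) => [|z].
  by rewrite ltr_wpDl// sumr_ge0.
have zk : size (mkseq z k) == k by rewrite size_mkseq.
rewrite (bigD1 (Tuple zk))//= -[g z](subrK (g (extend (mkseq z k)))).
rewrite (le_trans (ler_normD _ _))//.
have h1 : `|g z - g (extend (mkseq z k))| <= 1.
  by rewrite gk// mkseq_extend// size_mkseq.
have h2 : 0 <= \sum_(i in {: k.-tuple bool} | i != Tuple zk) `|g (extend i)|.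
  by rewrite sumr_ge0.
by move: h1 h2; lra.
Qed.

Lemma mkseq_le z z' j k : (j <= k)%N -> mkseq z k = mkseq z' k ->
  mkseq z j = mkseq z' j.
Proof.
move=> jk e; rewrite /mkseq; apply/eq_in_map => i; rewrite mem_iota add0n => /andP[_ ij].
have ik : (i < k)%N by exact: leq_trans ij jk.
by rewrite -(nth_mkseq false z ik) e nth_mkseq.
Qed.

Lemma cylinder_continuous_cst a : cylinder_continuous (fun=> a).
Proof. by move=> e e0; exists 0%N => z z' _; rewrite subrr normr0 ltW. Qed.

Lemma cylinder_continuousD g h : cylinder_continuous g -> cylinder_continuous h ->
  cylinder_continuous (fun z => g z + h z).
Proof.
move=> cg ch e e0; have e2 : 0 < e / 2 by rewrite divr_gt0.
have [k gk] := cg _ e2; have [l hl] := ch _ e2.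
exists (maxn k l) => z z' zz'.
have -> : g z + h z - (g z' + h z') = (g z - g z') + (h z - h z') by ring.
rewrite (le_trans (ler_normD _ _))// (splitr e) lerD//.
  by apply/gk/(mkseq_le _ zz'); exact: leq_maxl.
by apply/hl/(mkseq_le _ zz'); exact: leq_maxr.
Qed.

Lemma cylinder_continuousM g h : cylinder_continuous g -> cylinder_continuous h ->
  cylinder_continuous (fun z => g z * h z).
Proof.
move=> cg ch e e0.
have [M M0 gM] := cylinder_continuous_bounded cg.
have [N N0 hN] := cylinder_continuous_bounded ch.
have eN : 0 < e / 2 / N by rewrite !divr_gt0.
have eM : 0 < e / 2 / M by rewrite !divr_gt0.
have [k gk] := cg _ eN; have [l hl] := ch _ eM.
exists (maxn k l) => z z' zz'.
have -> : g z * h z - g z' * h z' = (g z - g z') * h z + g z' * (h z - h z') by ring.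
rewrite (le_trans (ler_normD _ _))// (splitr e) !normrM lerD//.
  rewrite -[leRHS](divfK (lt0r_neq0 N0)) ler_pM//.
  by apply/gk/(mkseq_le _ zz'); exact: leq_maxl.
rewrite -[leRHS](divfK (lt0r_neq0 M0)) mulrC ler_pM//.
by apply/hl/(mkseq_le _ zz'); exact: leq_maxr.
Qed.

Definition bits_sum z n : R := \sum_(j < n) (z j)%:R / 2 ^+ j.+1.

Definition bits_val z : R := sup (range (bits_sum z)).

Lemma bits_sum_le z k n : bits_sum z n <= bits_sum z k + 2 ^- k.
Proof.
have p2 j : 0 < (2 : R) ^- j by rewrite invr_gt0 exprn_gt0.
have [nk|kn] := leqP n k.
  rewrite /bits_sum -(subnKC nk) big_split_ord /= -addrA lerDl.
  apply: addr_ge0; last exact/ltW/p2.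
  by apply: sumr_ge0 => i _; rewrite mulr_ge0// ltW// p2.
(* Digits [k] to [n - 1] add at most [2 ^- k - 2 ^- n]; only this sharper bound passes through the
   induction. *)
suff: bits_sum z n <= bits_sum z k + 2 ^- k - 2 ^- n.
  by move=> /le_trans; apply; rewrite lerBlDr lerDl ltW// p2.
rewrite -(subnKC (ltnW kn)); elim: (n - k)%N => [|m IH].
  by rewrite addn0 addrK.
rewrite addnS {1}/bits_sum big_ord_recr /=; move: IH; rewrite {1}/bits_sum.
have -> : (2 : R) ^- (k + m) = 2 ^- (k + m).+1 + 2 ^- (k + m).+1.
  by rewrite exprS invfM; lra.
case: (z _); rewrite ?mul1r ?mul0r; move: (p2 (k + m).+1); lra.
Qed.

Lemma bits_val_bounds z k : bits_sum z k <= bits_val z <= bits_sum z k + 2 ^- k.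
Proof.
apply/andP; split.
  apply: ub_le_sup; last by exists k.
  by exists (bits_sum z 0 + 2 ^- 0) => _ [n _ <-]; exact: bits_sum_le.
by apply: ge_sup; [exists (bits_sum z 0), 0%N|move=> _ [n _ <-]; exact: bits_sum_le].
Qed.

Lemma exists_pow2_le (e : R) : 0 < e -> exists k, 2 ^- k <= e.
Proof.
move=> e0; have [n _ /(_ n (leqnn n)) ne] := near_infty_natSinv_expn_lt (PosNum e0).
exists n; apply/ltW; rewrite /= in ne.
by rewrite -div1r.
Qed.

Lemma bits_val_close z z' k : mkseq z k = mkseq z' k ->
  `|bits_val z - bits_val z'| <= 2 ^- k.
Proof.
move=> zz'; have /andP[a b] := bits_val_bounds z k.
have /andP[a' b'] := bits_val_bounds z' k.
have e : bits_sum z k = bits_sum z' k.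
  apply: eq_bigr => i _.
  by rewrite -(nth_mkseq false z (ltn_ord i)) zz' nth_mkseq.
by rewrite ler_norml; apply/andP; split; lra.
Qed.

Lemma bits_val_surj (y : R) : 0 <= y <= 1 -> exists z, bits_val z = y.
Proof.
move=> y01.
(* The orbit of [y] under the doubling map; the digit is 1 when the orbit is at least one half. The
   endpoint 1 is fixed and receives only digits 1. *)
pose Y := fix Y n : R := if n is n'.+1 then 2 * Y n' - (2^-1 <= Y n')%R%:R else y.
pose z n := 2^-1 <= Y n.
have Y01 n : 0 <= Y n <= 1.
  elim: n => //= n /andP[h0 h1]; case: (lerP 2^-1 (Y n)) => /= h; apply/andP; split; lra.
have yE n : y = bits_sum z n + Y n * 2 ^- n.
  elim: n => [|n IH]; first by rewrite /bits_sum big_ord0 /= invr1 mulr1 add0r.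
  rewrite {1}IH /bits_sum big_ord_recr /= -addrA; congr (_ + _).
  rewrite -/(z n) exprS invfM; field.
  by rewrite expf_neq0.
(* For every [k], both numbers lie between [bits_sum z k] and [bits_sum z k + 2 ^- k]. *)
exists z; apply/eqP; rewrite -subr_eq0 -normr_le0; apply/ler_addgt0Pl => e e0.
have [k ke] := exists_pow2_le e0; rewrite addr0 (le_trans _ ke)//.
have /andP[a b] := bits_val_bounds z k; have /andP[c d] := Y01 k.
have p0 : 0 < (2 : R) ^- k by rewrite invr_gt0 exprn_gt0.
have q0 : 0 <= Y k * 2 ^- k by rewrite mulr_ge0// ltW.
have q1 : Y k * 2 ^- k <= 2 ^- k by rewrite ler_piMl// ltW.
move: (yE k) => yEk; rewrite ler_norml; apply/andP; split; lra.
Qed.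
End Bitstreams.

(** * Positive functionals on bit streams *)

Section PositiveFunctional.
Context {R : realType} {T : Type} (L : (T -> R) -> R).
Implicit Types f g : T -> R.

Definition norm_bounded f := exists M : R, forall z, `|f z| <= M.

(** The laws are required on bounded functions only, since these are the functions on which an
    ultralimit of functionals is sure to exist. *)
Definition positive_functional :=
  [/\ forall f g, norm_bounded f -> norm_bounded g ->
        L (fun z => f z + g z) = L f + L g,
      forall a f, norm_bounded f -> L (fun z => a * f z) = a * L f &
      forall f, norm_bounded f -> (forall z, 0 <= f z) -> 0 <= L f].

Lemma norm_bounded_cst a : norm_bounded (fun=> a).
Proof. by exists `|a|. Qed.

Lemma norm_boundedD f g : norm_bounded f -> norm_bounded g ->
  norm_bounded (fun z => f z + g z).
Proof.
move=> [M fM] [N gN]; exists (M + N) => z.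
by rewrite (le_trans (ler_normD _ _))// lerD.
Qed.

Lemma norm_boundedZ a f : norm_bounded f -> norm_bounded (fun z => a * f z).
Proof. by move=> [M fM]; exists (`|a| * M) => z; rewrite normrM ler_wpM2l. Qed.

Lemma norm_bounded_sum (I : Type) (r : seq I) (F : I -> T -> R) :
  (forall i, norm_bounded (F i)) -> norm_bounded (fun z => \sum_(i <- r) F i z).
Proof.
move=> bF; elim: r => [|i r IH].
  by exists 0 => z; rewrite big_nil normr0.
have [M FM] := norm_boundedD (bF i) IH.
by exists M => z; rewrite big_cons.
Qed.

Lemma norm_bounded_indicator (b : T -> bool) : norm_bounded (fun z => (b z)%:R).
Proof. by exists 1 => z; case: (b z); rewrite ?normr1 ?normr0. Qed.

Hypothesis posL : positive_functional.

Let LD f g : norm_bounded f -> norm_bounded g ->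
  L (fun z => f z + g z) = L f + L g.
Proof. by case: posL => + _ _; exact. Qed.

Let LZ a f : norm_bounded f -> L (fun z => a * f z) = a * L f.
Proof. by case: posL => _ + _; exact. Qed.

Let L_ge0 f : norm_bounded f -> (forall z, 0 <= f z) -> 0 <= L f.
Proof. by case: posL => _ _; exact. Qed.

Lemma positive_functional0 : L (fun=> 0) = 0.
Proof.
have := LZ 0 (norm_bounded_cst 0).
by under eq_fun do rewrite mul0r; rewrite mul0r.
Qed.

Lemma positive_functional_cst a : L (fun=> a) = a * L (fun=> 1).
Proof.
by rewrite -LZ; [under [in RHS]eq_fun do rewrite mulr1|exact: norm_bounded_cst].
Qed.

Lemma positive_functional_sum (I : Type) (r : seq I) (F : I -> T -> R) :
  (forall i, norm_bounded (F i)) ->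
  L (fun z => \sum_(i <- r) F i z) = \sum_(i <- r) L (F i).
Proof.
move=> bF; elim: r => [|i r IH].
  rewrite big_nil; apply: etrans positive_functional0.
  by congr L; apply/funext => z; rewrite big_nil.
rewrite big_cons -IH -LD//; last exact: norm_bounded_sum.
by congr L; apply/funext => z; rewrite big_cons.
Qed.

Lemma positive_functionalB f g : norm_bounded f -> norm_bounded g ->
  L (fun z => f z - g z) = L f - L g.
Proof.
move=> bf bg; rewrite -mulN1r -LZ// -LD//; last exact: norm_boundedZ.
by congr L; apply/funext => z; rewrite mulN1r.
Qed.

Lemma positive_functional_le f g : norm_bounded f -> norm_bounded g ->
  (forall z, f z <= g z) -> L f <= L g.
Proof.
move=> bf bg fg; rewrite -subr_ge0 -positive_functionalB//; apply: L_ge0.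
  have [M] := norm_boundedD bg (norm_boundedZ (-1) bf).
  by move=> gM; exists M => z; rewrite -mulN1r.
by move=> z; rewrite subr_ge0.
Qed.

(** Monotonicity applied to [g - e <= f <= g + e]: positivity makes [L] Lipschitz for the sup norm,
    with constant [L 1]. *)
Lemma positive_functional_close f g e : norm_bounded f -> norm_bounded g ->
  (forall z, `|f z - g z| <= e) -> `|L f - L g| <= e * L (fun=> 1).
Proof.
move=> bf bg fg; have be := norm_bounded_cst e.
rewrite ler_distl; apply/andP; split.
  rewrite lerBlDr -positive_functional_cst -LD//.
  apply: positive_functional_le => // [|z]; first exact: norm_boundedD.
  by move: (fg z); rewrite ler_distlC => /andP[]; lra.
rewrite -positive_functional_cst -LD//.
apply: positive_functional_le => // [|z]; first exact: norm_boundedD.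
by move: (fg z); rewrite ler_distl => /andP[].
Qed.
End PositiveFunctional.

(** * Realisation of a functional by Lebesgue measure on an interval *)

Section CylinderMeasure.
Context {R : realType} (L : ((nat -> bool) -> R) -> R).
Hypothesis posL : positive_functional L.
Implicit Types (s : seq bool) (z : nat -> bool) (t : R).

Definition cylinder_mass s : R := L (fun z => (mkseq z (size s) == s)%:R).
Local Notation c := (L (fun=> 1)).

Lemma cylinder_mass_ge0 s : 0 <= cylinder_mass s.
Proof.
case: posL => _ _; apply => [|z]; first exact: norm_bounded_indicator.
by rewrite ler0n.
Qed.

Lemma cylinder_mass_nil : cylinder_mass [::] = c.
Proof. by []. Qed.

Lemma cylinder_mass_rcons s :
  cylinder_mass s = cylinder_mass (rcons s false) + cylinder_mass (rcons s true).
Proof.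
have [LD _ _] := posL; rewrite /cylinder_mass -LD; last 2 first.
- exact: norm_bounded_indicator.
- exact: norm_bounded_indicator.
congr L; apply/funext => z; rewrite !size_rcons mkseqS !eqseq_rcons.
by case: (_ == s); case: (z _); rewrite /= ?addr0 ?add0r.
Qed.

(* The total mass of the words of the same length that precede [s] lexicographically. *)
Definition left_end s : R :=
  \sum_(i < size s) (if nth false s i then cylinder_mass (rcons (take i s) false) else 0).

(** The interval of [s] is cut in two: the child [false] keeps its left end, and the child [true]
    starts where [false] stops. *)
Lemma left_end_rcons s b :
  left_end (rcons s b) = left_end s + (if b then cylinder_mass (rcons s false) else 0).
Proof.
have tk i : (i <= size s)%N -> take i (rcons s b) = take i s.
  by move=> ik; rewrite -cats1 takel_cat.
rewrite /left_end size_rcons big_ord_recr /=; congr (_ + _).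
  by apply: eq_bigr => i _; rewrite nth_rcons ltn_ord tk// ltnW.
by rewrite nth_rcons ltnn eqxx tk// take_size.
Qed.

Lemma left_end_bounds s : 0 <= left_end s /\ left_end s + cylinder_mass s <= c.
Proof.
elim/last_ind: s => [|s b [IH1 IH2]].
  by rewrite /left_end big_ord0 add0r cylinder_mass_nil.
rewrite left_end_rcons; move: IH1 IH2.
move: (cylinder_mass_ge0 (rcons s false)) (cylinder_mass_ge0 (rcons s true)).
by rewrite (cylinder_mass_rcons s); case: b => *; split; lra.
Qed.

(* The word [w] of length [k] with [left_end w <= t < left_end w + cylinder_mass w];
   only meaningful for [0 <= t < L 1]. *)
Fixpoint path_to t k : seq bool :=
  if k is k'.+1 then
    rcons (path_to t k')
      (left_end (path_to t k') + cylinder_mass (rcons (path_to t k') false) <= t)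
  else [::].

(** The infinite stream whose prefixes are the words [path_to t k]; as a function of [t] it is the
    random bit stream. *)
Definition branch t k : bool :=
  left_end (path_to t k) + cylinder_mass (rcons (path_to t k) false) <= t.

Lemma mkseq_branch t k : mkseq (branch t) k = path_to t k.
Proof. by elim: k => // k IH; rewrite mkseqS IH. Qed.

Lemma size_path_to t k : size (path_to t k) = k.
Proof. by rewrite -mkseq_branch size_mkseq. Qed.

(** The cells of the words of a given length partition [[0, c[], and [path_to] returns the word of
    the cell containing [t]. *)
Lemma path_toE t s : 0 <= t < c ->
  (path_to t (size s) == s) = (left_end s <= t < left_end s + cylinder_mass s).
Proof.
move=> t0c; elim/last_ind: s => [|s b IH].
  by rewrite /= eqxx /left_end big_ord0 add0r cylinder_mass_nil t0c.
rewrite size_rcons /= eqseq_rcons left_end_rcons.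
have [e|/negbTE ne] := eqVneq (path_to t (size s)) s.
  move: IH; rewrite e eqxx => /esym/andP[h1 h2] /=; case: b.
    by rewrite eqb_id -addrA -cylinder_mass_rcons h2 andbT.
  by rewrite eqbF_neg addr0 h1 ltNge.
(* If the path has already left [s], then [t] is outside the cell of [s], hence outside the smaller
   cell of [rcons s b]. *)
move: IH; rewrite ne /= => IH; apply/esym/negbTE/negP => /andP[h1 h2].
have : left_end s <= t < left_end s + cylinder_mass s; last by rewrite -IH.
move: h1 h2 (cylinder_mass_ge0 (rcons s false)) (cylinder_mass_ge0 (rcons s true)).
rewrite (cylinder_mass_rcons s).
by case: b => *; apply/andP; split; lra.
Qed.

Local Notation D := (`[0, c[%classic : set R).
Local Notation leb := (@lebesgue_measure R).

(** The half-open cell of the prefix contains [t], so it has positive length. Thus a branch never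
    enters a word of mass zero, which later confines the branches to the sphere. *)
Lemma cylinder_mass_path_gt0 t k : D t -> 0 < cylinder_mass (path_to t k).
Proof.
rewrite /= in_itv /= => tD.
have := path_toE (path_to t k) tD; rewrite size_path_to eqxx => /esym/andP[h1 h2].
by lra.
Qed.

Definition cell s : set R := `[left_end s, left_end s + cylinder_mass s[.

Lemma cellE t s : D t -> (t \in cell s) = (path_to t (size s) == s).
Proof. by rewrite /= in_itv /= => tD; rewrite path_toE// mem_setE in_itv. Qed.

Lemma cell_sub s : cell s `<=` D.
Proof.
have [h1 h2] := left_end_bounds s.
by move=> t; rewrite /cell /= !in_itv /= => /andP[h3 h4]; apply/andP; split; lra.
Qed.

Lemma measurable_cell s : measurable (cell s).
Proof. exact: measurable_itv. Qed.

(** Exactly one cell of level [k] contains [t], so a function of the prefix is a finite combination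
    of indicators of intervals. *)
Lemma step_fun_path (h : seq bool -> R) k t : D t ->
  h (path_to t k) = \sum_(s : k.-tuple bool) h s * \1_(cell s) t.
Proof.
move=> tD; have pk : size (path_to t k) == k by rewrite size_path_to.
rewrite (bigD1 (Tuple pk))//= indicE cellE// size_path_to eqxx mulr1.
rewrite big1 ?addr0// => s sne; rewrite indicE cellE// size_tuple.
case: eqP => [e|]; last by rewrite mulr0.
by case/eqP: sne; apply: val_inj; rewrite /= e.
Qed.

Lemma measurable_step (h : seq bool -> R) k :
  measurable_fun D (fun t => h (path_to t k)).
Proof.
apply: (eq_measurable_fun
  (fun t => \sum_(s : k.-tuple bool) h s * \1_(cell s) t)) => [t|].
  by rewrite inE => tD; rewrite -step_fun_path.
apply: measurable_sum => s; apply: measurable_funM; first exact: measurable_cst.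
apply: measurable_indic; exact: measurable_cell.
Qed.

(** A pointwise limit of step functions: truncate the branch at level [k] and pad it with
    [false]. *)
Lemma measurable_branch (g : (nat -> bool) -> R) : cylinder_continuous g ->
  measurable_fun D (fun t => g (branch t)).
Proof.
move=> cg.
apply: (@measurable_fun_cvg _ _ _ _ (fun k t => g (extend (path_to t k)))).
  by move=> k; apply: (measurable_step (g \o extend)).
move=> t tD; apply/cvgrPdist_le => e e0; have [k gk] := cg e e0.
exists k => // n /= kn; apply: gk; apply: (mkseq_le kn).
by rewrite mkseq_branch mkseq_extend// size_path_to.
Qed.

Lemma lebesgue_cell s : leb (cell s) = (cylinder_mass s)%:E.
Proof.
rewrite /cell lebesgue_measure_itv /= lte_fin ltrDl.
case: (ltP 0 (cylinder_mass s)) => h; last first.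
  by congr EFin; apply/le_anti; rewrite h cylinder_mass_ge0.
by rewrite -EFinB addrC addKr.
Qed.

Lemma lebesgue_branch_domain : leb D = c%:E.
Proof. by rewrite -cylinder_mass_nil -lebesgue_cell /cell /left_end big_ord0 add0r. Qed.

Lemma integrable_branch_domain (f : R -> R) M : measurable_fun D f ->
  (forall t, D t -> `|f t| <= M) -> leb.-integrable D (EFin \o f).
Proof.
move=> mf fM; apply: measurable_bounded_integrable => //.
- exact: (eq_ind_r (fun x => (x < +oo)%E) (ltry c) lebesgue_branch_domain).
- by exists M; split => [|x Mx t tD]; [exact: num_real|exact: le_trans (fM _ tD) (ltW Mx)].
Qed.

Lemma integral_step (h : seq bool -> R) k :
  Rintegral leb D (fun t => h (path_to t k)) =
  \sum_(s : k.-tuple bool) h s * cylinder_mass s.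
Proof.
rewrite (@eq_Rintegral _ _ _ leb D (fun t => \sum_(s : k.-tuple bool) h s * \1_(cell s) t));
  last first.
  by move=> t; rewrite inE => tD; rewrite -step_fun_path.
have mi s : measurable_fun D (\1_(cell s) : R -> R).
  apply: measurable_indic; exact: measurable_cell.
have ii s : leb.-integrable D (EFin \o (\1_(cell s) : R -> R)).
  apply: (@integrable_branch_domain _ 1) => // t _; rewrite indicE.
  by case: (_ \in _); rewrite ?normr1 ?normr0.
elim: (index_enum _) => [|s r IH].
  rewrite big_nil (@eq_Rintegral _ _ _ leb D (fun=> 0)) => [|t _]; last by rewrite big_nil.
  by rewrite Rintegral_cst ?mul0r.
rewrite big_cons -IH (@eq_Rintegral _ _ _ leb D (fun t => h s * \1_(cell s) t +
   \sum_(s <- r) h s * \1_(cell s) t)) => [|t _]; last by rewrite big_cons.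
rewrite RintegralD//; last first.
- apply: (@integrable_branch_domain _ (\sum_(s <- r) `|h s|)).
    apply: measurable_sum => u; apply: measurable_funM => //; exact: measurable_cst.
  move=> t _; rewrite (le_trans (ler_norm_sum _ _ _))// ler_sum// => u _.
  by rewrite normrM indicE; case: (_ \in _); rewrite ?normr1 ?normr0 ?mulr1 ?mulr0.
- by apply: (@integrableZl _ _ _ leb D _ (h s) (EFin \o \1_(cell s))).
congr (_ + _); rewrite RintegralZl//; congr (_ * _).
rewrite /Rintegral integral_indic//; last exact: measurable_cell.
rewrite (_ : cell s `&` _ = cell s); last exact/setIidl/cell_sub.
exact: (congr1 fine (lebesgue_cell s)).
Qed.

(** Both sides are within [e / 2] of the same finite sum of [g (extend s)] weighted by the masses of
    the words of length [k]: the integral by the step functions, [L] by its Lipschitz bound. *)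
Lemma integral_branch (g : (nat -> bool) -> R) : cylinder_continuous g ->
  Rintegral leb D (fun t => g (branch t)) = L g.
Proof.
move=> cg; have [M M0 gM] := cylinder_continuous_bounded cg.
have bg : norm_bounded g by exists M.
have c0 : 0 <= c by rewrite -cylinder_mass_nil cylinder_mass_ge0.
have mg := measurable_branch cg.
apply/eqP; rewrite -subr_eq0 -normr_le0; apply/ler_addgt0Pl => e e0; rewrite addr0.
(* The total mass [c] may be zero, so the division is by [c + 1]. *)
have e'0 : 0 < e / 2 / (c + 1) by rewrite !divr_gt0// ltr_wpDl.
have [k gk] := cg _ e'0; set e' := e / 2 / (c + 1) in gk.
have e'c : e' * c <= e / 2.
  rewrite /e' mulrAC ler_pdivrMr ?ltr_wpDl// ler_wpM2l ?lerDl// ltW//.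
  by rewrite divr_gt0.
pose h s := g (extend s).
have I1 : `|Rintegral leb D (fun t => g (branch t)) -
    \sum_(s : k.-tuple bool) h s * cylinder_mass s| <= e / 2.
  rewrite -integral_step.
  have i1 : leb.-integrable D (EFin \o (fun t => g (branch t))).
    exact: (@integrable_branch_domain _ M).
  have i2 : leb.-integrable D (EFin \o (fun t => h (path_to t k))).
    apply: (@integrable_branch_domain _ M) => [|t _]; last exact: gM.
    exact: (measurable_step h k).
  rewrite -RintegralB//.
  have i3 : leb.-integrable D (EFin \o (fun t => g (branch t) - h (path_to t k))).
    exact: (@integrableB _ _ _ leb D _ (EFin \o (fun t => g (branch t)))
      (EFin \o (fun t => h (path_to t k)))).
  rewrite (le_trans (le_normr_Rintegral _ _))//.
  apply: le_trans e'c.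
  have -> : e' * c = Rintegral leb D (fun=> e').
    rewrite Rintegral_cst//; congr (_ * _).
    exact/esym/(congr1 fine lebesgue_branch_domain).
  apply: le_Rintegral => //.
  - exact: (integrable_norm i3).
  - by apply: (@integrable_branch_domain _ `|e'|) => //; exact: measurable_cst.
  - by move=> t _; apply: gk; rewrite mkseq_branch mkseq_extend// size_path_to.
have I2 : `|L g - \sum_(s : k.-tuple bool) h s * cylinder_mass s| <= e / 2.
  pose F (s : k.-tuple bool) z := h s * (mkseq z k == s)%:R.
  have bF (s : k.-tuple bool) : norm_bounded (F s).
    exact/norm_boundedZ/norm_bounded_indicator.
  have -> : \sum_(s : k.-tuple bool) h s * cylinder_mass s =
      L (fun z => \sum_(s : k.-tuple bool) F s z).
    rewrite positive_functional_sum//; apply: eq_bigr => s _.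
    have [_ LZ _] := posL; rewrite LZ; last exact: norm_bounded_indicator.
    by rewrite /cylinder_mass size_tuple.
  apply: le_trans e'c; apply: positive_functional_close => // [|z].
    exact: norm_bounded_sum.
  have zk : size (mkseq z k) == k by rewrite size_mkseq.
  rewrite (bigD1 (Tuple zk))//= big1 => [|s sne]; last first.
    rewrite /F; case: eqP => [e1|]; last by rewrite mulr0.
    by case/eqP: sne; apply: val_inj.
  by rewrite addr0 /F eqxx mulr1 gk// mkseq_extend// size_mkseq.
rewrite distrC in I2; rewrite (splitr e) (le_trans (ler_distD _ _ _) (lerD I1 I2))//.
Qed.
End CylinderMeasure.

(** * From functionals to measures on the sphere *)

Section SphereMeasure.
Context {R : realType}.
Local Notation S := (@qsphere R : set (R * R * R * R)%type).
Local Notation leb := (@lebesgue_measure R).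

(** As [X] is defined on the whole line, its pushforward may be infinite; restricted to [S], it sees
    only the part coming from [D], whose Lebesgue measure is finite. *)
Lemma sphere_pushforward (X : R -> quat R) (D : set R) :
  measurable_fun setT (X : R -> (R * R * R * R)%type) ->
  X @^-1` S = D -> (leb D < +oo)%E ->
  exists mu : {finite_measure set (quat R) -> \bar R}, mu (~` S) = 0%E /\
    forall f : quat R -> R, measurable_fun setT f ->
      leb.-integrable D (EFin \o (fun t => f (X t))) ->
      Rintegral mu S f = Rintegral leb D (fun t => f (X t)).
Proof.
move=> mX XD lebD.
pose nu : {measure set (R * R * R * R)%type -> \bar R} :=
  @measure_function_pushforward__canonical__measure_function_Measure _ _ _ _ _ leb _ mX.
have nuS : (nu S < +oo)%E by rewrite /nu /= /pushforward XD.
have mS : measurable S := measurable_qsphere.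
exists (mfrestr mS nuS : {finite_measure set (R * R * R * R)%type -> \bar R}).
split; first by rewrite /= /mfrestr /mrestr setICl measure0.
move=> f mf intf; rewrite /Rintegral; congr fine.
rewrite (@eq_measure_integral _ _ _ _ nu); last first.
  by move=> A mA AS; rewrite /= /mfrestr /mrestr (setIidl AS).
rewrite -XD in intf *.
apply: (@integral_pushforward _ _ (measurableTypeR R) _ _ X mX leb S (EFin \o f)) => //.
exact/measurable_EFinP.
Qed.

(* The binary digits of the four coordinates, rescaled from [[0, 1]] to [[-1, 1]],
   are interleaved. *)
Definition quat_of_bits (z : nat -> bool) : quat R :=
  mkq (2 * bits_val (fun j => z (4 * j)%N) - 1)
      (2 * bits_val (fun j => z (4 * j + 1)%N) - 1)
      (2 * bits_val (fun j => z (4 * j + 2)%N) - 1)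
      (2 * bits_val (fun j => z (4 * j + 3)%N) - 1).

Lemma quat_of_bits_surj s : S s -> exists z, quat_of_bits z = s.
Proof.
move=> Ss; have [s0 s1 s2 s3] := qsphere_le1 Ss.
have surj (a : R) : `|a| <= 1 -> exists z, 2 * bits_val z - 1 = a.
  rewrite ler_norml => /andP[a0 a1].
  have [|z zE] := @bits_val_surj R ((a + 1) / 2); first by apply/andP; split; lra.
  by exists z; rewrite zE; lra.
have [z0 e0] := surj _ s0; have [z1 e1] := surj _ s1.
have [z2 e2] := surj _ s2; have [z3 e3] := surj _ s3.
(* The remainder modulo 4 selects the coordinate, the quotient selects its digit. *)
pose z i := nth z0 [:: z0; z1; z2; z3] (i %% 4)%N (i %/ 4)%N.
have zE l (j : nat) : (l < 4)%N -> z (4 * j + l)%N = nth z0 [:: z0; z1; z2; z3] l j.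
  move=> l4; rewrite /z mulnC modnMDl divnMDl// (modn_small l4) divn_small//.
  by rewrite addn0.
exists z; apply: quatP; rewrite /quat_of_bits /mkq /qre /qi /qj /qk /=.
- rewrite -[RHS]e0; congr (2 * bits_val _ - 1); apply/funext => j.
  by have := @zE 0%N j isT; rewrite addn0.
- by rewrite -[RHS]e1; congr (2 * bits_val _ - 1); apply/funext => j; exact: zE 1%N j isT.
- by rewrite -[RHS]e2; congr (2 * bits_val _ - 1); apply/funext => j; exact: zE 2%N j isT.
- by rewrite -[RHS]e3; congr (2 * bits_val _ - 1); apply/funext => j; exact: zE 3%N j isT.
Qed.

(** A prefix of [4 * k] bits fixes the first [k] digits of each coordinate. *)
Lemma cylinder_continuous_digits l : (l < 4)%N ->
  cylinder_continuous (fun z => 2 * bits_val (fun j => z (4 * j + l)%N) - 1 : R).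
Proof.
move=> l4; apply: cylinder_continuousD; last exact: cylinder_continuous_cst.
apply: cylinder_continuousM; first exact: cylinder_continuous_cst.
move=> e e0; have [k ke] := exists_pow2_le e0.
exists (4 * k)%N => z z' zz'; apply: le_trans ke; apply: bits_val_close.
apply/eq_in_map => j; rewrite mem_iota add0n => /andP[_ jk].
have jlk : (4 * j + l < 4 * k)%N.
  apply: (@leq_trans (4 * j.+1)); first by rewrite mulnSr ltn_add2l.
  by rewrite leq_mul2l.
by rewrite -(nth_mkseq false z jlk) zz' nth_mkseq.
Qed.

Definition qcylinder_continuous (G : (nat -> bool) -> quat R) :=
  [/\ cylinder_continuous (@qre R \o G), cylinder_continuous (@qi R \o G),
      cylinder_continuous (@qj R \o G) & cylinder_continuous (@qk R \o G)].

Lemma cylinder_continuousB (g h : (nat -> bool) -> R) :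
  cylinder_continuous g -> cylinder_continuous h ->
  cylinder_continuous (fun z => g z - h z).
Proof.
move=> cg ch; apply: cylinder_continuousD => //.
have := cylinder_continuousM (cylinder_continuous_cst (-1)) ch.
by under eq_fun do rewrite mulN1r.
Qed.

Lemma qcylinder_continuousM F G : qcylinder_continuous F -> qcylinder_continuous G ->
  qcylinder_continuous (fun z => qmul (F z) (G z)).
Proof.
move=> [F0 F1 F2 F3] [G0 G1 G2 G3]; split.
- apply: cylinder_continuousB; last exact: cylinder_continuousM.
  apply: cylinder_continuousB; last exact: cylinder_continuousM.
  by apply: cylinder_continuousB; apply: cylinder_continuousM.
- apply: cylinder_continuousB; last exact: cylinder_continuousM.
  apply: cylinder_continuousD; last exact: cylinder_continuousM.
  by apply: cylinder_continuousD; apply: cylinder_continuousM.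
- apply: cylinder_continuousD; last exact: cylinder_continuousM.
  apply: cylinder_continuousD; last exact: cylinder_continuousM.
  by apply: cylinder_continuousB; apply: cylinder_continuousM.
- apply: cylinder_continuousD; last exact: cylinder_continuousM.
  apply: cylinder_continuousB; last exact: cylinder_continuousM.
  by apply: cylinder_continuousD; apply: cylinder_continuousM.
Qed.

Lemma qcylinder_continuous_quat_of_bits : qcylinder_continuous quat_of_bits.
Proof.
split; last 3 first.
- exact: (@cylinder_continuous_digits 1).
- exact: (@cylinder_continuous_digits 2).
- exact: (@cylinder_continuous_digits 3).
have := @cylinder_continuous_digits 0 isT.
congr cylinder_continuous; apply/funext => z; rewrite /quat_of_bits /qre /=.
by congr (2 * bits_val _ - 1); apply/funext => j; rewrite addn0.
Qed.

Lemma qcylinder_continuous_pown n :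
  qcylinder_continuous (fun z => qpown (quat_of_bits z) n).
Proof.
elim: n => [|n IH]; first by split; exact: cylinder_continuous_cst.
exact: qcylinder_continuousM qcylinder_continuous_quat_of_bits IH.
Qed.

(** The measure is the law of [quat_of_bits (branch L t)] for [t] in [[0, L 1[]. The vanishing
    hypothesis gives mass zero to every word that begins no code of a sphere point. *)
Lemma sphere_measure_of_functional (L : ((nat -> bool) -> R) -> R) :
  positive_functional L ->
  (forall g, norm_bounded g -> (forall z, S (quat_of_bits z) -> g z = 0) -> L g = 0) ->
  exists mu : {finite_measure set (quat R) -> \bar R}, mu (~` S) = 0%E /\
    forall n, qint mu (fun s => qpown s n) =
      mkq (L (fun z => qre (qpown (quat_of_bits z) n)))
          (L (fun z => qi (qpown (quat_of_bits z) n)))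
          (L (fun z => qj (qpown (quat_of_bits z) n)))
          (L (fun z => qk (qpown (quat_of_bits z) n))).
Proof.
move=> posL suppL; set D := `[0, L (fun=> 1)[%classic : set R.
have mD : measurable D by exact: measurable_itv.
have [c0 c1 c2 c3] := qcylinder_continuous_quat_of_bits.
have SX t : D t -> S (quat_of_bits (branch L t)).
  move=> tD; pose g z := qnorm2 (quat_of_bits z) - 1.
  have cg : cylinder_continuous g.
    apply: cylinder_continuousB; last exact: cylinder_continuous_cst.
    rewrite /qnorm2; do 3?[apply: cylinder_continuousD];
      by under eq_fun do rewrite expr2; apply: cylinder_continuousM.
  suff : g (branch L t) = 0 by move=> /eqP; rewrite subr_eq0 => /eqP.
  apply/eqP; rewrite -normr_le0; apply/ler_addgt0Pl => e e0; rewrite addr0.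
  have [k gk] := cg _ e0.
  (* The prefix has positive mass, so it begins the code [z] of some sphere point; there [g]
     vanishes, and continuity bounds [g] by [e] on the branch. *)
  have [z [Sz zt]] : exists z, S (quat_of_bits z) /\ mkseq z k = path_to L t k.
    apply: contrapT => noz.
    have := cylinder_mass_path_gt0 posL k tD.
    rewrite /cylinder_mass (suppL _ (norm_bounded_indicator _)) ?ltxx//.
    move=> z Sz; rewrite size_path_to; case: eqP => // e1.
    by exfalso; apply: noz; exists z.
  have := gk (branch L t) z; rewrite mkseq_branch zt => /(_ erefl).
  have -> : g z = 0 by rewrite /g Sz subrr.
  by rewrite subr0.
(* The default value [qzero] is off the sphere, so the preimage of the sphere is exactly [D]. *)
pose X t := if t \in D then quat_of_bits (branch L t) else qzero R.
have XD : X @^-1` S = D.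
  apply/seteqP; split=> t; rewrite /preimage /= /X.
    case: ifPn => [/set_mem//|_].
    rewrite /qsphere /qnorm2 /qzero /mkq /qre /qi /qj /qk /= expr0n /= !addr0.
    by move/esym/eqP; rewrite oner_eq0.
  by move=> tD; rewrite mem_set//; exact: SX.
have lebD : (leb D < +oo)%E.
  exact: (eq_ind_r (fun x => (x < +oo)%E) (ltry _) (lebesgue_branch_domain posL)).
have mXc (p : quat R -> R) : p (qzero R) = 0 ->
    cylinder_continuous (fun z => p (quat_of_bits z)) ->
    measurable_fun setT (fun t => p (X t)).
  move=> p0 cp; have := (measurable_restrictT _ mD).1 (measurable_branch posL cp).
  congr measurable_fun; apply/funext => t; rewrite patchE /X.
  by case: ifPn => // _.
have mX : measurable_fun setT (X : R -> (R * R * R * R)%type).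
  rewrite (_ : X = fun t => (qre (X t), qi (X t), qj (X t), qk (X t))); last first.
    by apply/funext => t; case: (X t) => [[[]]].
  do 3?[apply: measurable_fun_pair]; exact: mXc.
have [mu [mu0 muE]] := sphere_pushforward mX XD lebD.
exists mu; split => // n.
have [p0 p1 p2 p3] := qcylinder_continuous_pown n.
have [m0 m1 m2 m3] := @qmeasurable_pown R n.
have comp (p : quat R -> R) : measurable_fun setT p ->
    cylinder_continuous (fun z => p (quat_of_bits z)) ->
    Rintegral mu S p = L (fun z => p (quat_of_bits z)).
  move=> mp cp; rewrite -(integral_branch posL cp).
  have e : {in D, (fun t => p (quat_of_bits (branch L t))) =1 (fun t => p (X t))}.
    by move=> t tD; rewrite /X tD.
  have [M M0 pM] := cylinder_continuous_bounded cp.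
  rewrite muE//; first exact/esym/eq_Rintegral.
  apply: (@integrable_branch_domain _ _ posL _ M); last first.
    by move=> t tD; rewrite /X mem_set.
  by apply: (eq_measurable_fun _ e); exact: (measurable_branch posL cp).
by rewrite /qint; congr mkq; apply: comp.
Qed.
End SphereMeasure.

(** * Limits of functionals and trigonometric sums *)

(** For [A] in a finer proper filter [G], the preimage of [A] or its complement belongs to [F]; the
    second case would put the empty set in [G]. *)
Lemma ultra_fmap (T V : Type) (f : T -> V) (F : set_system T) :
  UltraFilter F -> UltraFilter (f @ F).
Proof.
move=> UF; have PF : ProperFilter F by exact: ultra_proper.
split; first exact: fmap_proper_filter.
move=> G PG sub; apply/predeqP => A; split => [GA|]; last exact: sub.
have [//|FC] := in_ultra_setVsetC (f @^-1` A) UF.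
have /filter_ex[y []//] : G (A `&` ~` A) by apply: filterI => //; exact: sub.
Qed.

(** For bounded [f] the values [L_ N f] stay in a compact segment, so they converge along an
    ultrafilter refining [\oo]. Linearity and positivity pass to the limit, and an ordinary limit is
    kept. *)
Lemma positive_functional_ultralimit (R : realType) (T : Type)
    (L_ : nat -> (T -> R) -> R) (C : R) :
  (forall N, positive_functional (L_ N)) -> (forall N, L_ N (fun=> 1) <= C) ->
  exists2 L, positive_functional L & forall f l, norm_bounded f ->
    L_ ^~ f @ \oo --> l -> L f = l.
Proof.
move=> posL LC.
have [U [UU sub]] := @ultraFilterLemma _ (\oo : set_system nat) _.
have PU : ProperFilter U by exact: ultra_proper.
have cvgU f : norm_bounded f -> exists l : R, L_ ^~ f @ U --> l.
  move=> bf; have [M fM] := bf.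
  (* The absolute value guards against an empty [T], for which [M] could be negative. *)
  have K := @segment_compact R (- (`|M| * C)) (`|M| * C).
  rewrite compact_ultra in K.
  have UI : UltraFilter ((L_ ^~ f) @ U) by exact: ultra_fmap.
  suff h : ((L_ ^~ f) @ U) (`[(- (`|M| * C)), (`|M| * C)]%classic).
    by have [l [_ Ul]] := K _ UI h; exists l.
  apply: (@filterS _ U _ setT _ _ filterT) => N _ /=; rewrite in_itv /= -ler_norml.
  have := @positive_functional_close _ _ _ (posL N) f (fun=> 0) `|M| bf
    (norm_bounded_cst 0).
  rewrite (positive_functional0 (posL N)) subr0 => h.
  apply: le_trans (h _) _; last by rewrite ler_wpM2l.
  by move=> z; rewrite subr0 (le_trans (fM z))// ler_norm.
pose L f : R := lim (L_ ^~ f @ U).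
have LP f : norm_bounded f -> L_ ^~ f @ U --> L f.
  by move=> /cvgU[l Ul]; rewrite /L (cvg_lim _ Ul).
exists L; last first.
  move=> f l bf fl; apply: cvg_lim => //.
  by apply: cvg_trans fl; apply: cvg_app.
split.
- move=> f g bf bg; apply: cvg_lim => //.
  have -> : (fun N => L_ N (fun z => f z + g z)) = (fun N => L_ N f + L_ N g).
    by apply/funext => N; have [h _ _] := posL N; exact: h.
  exact: cvgD (LP _ bf) (LP _ bg).
- move=> a f bf; apply: cvg_lim => //.
  have -> : (fun N => L_ N (fun z => a * f z)) = (fun N => a * L_ N f).
    by apply/funext => N; have [_ h _] := posL N; exact: h.
  exact: cvgMr (LP _ bf).
- move=> f bf f0; apply: limr_ge.
    by apply/cvg_ex; exists (L f); exact: LP.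
  by apply: filterS filterT => N _; have [_ _ h] := posL N; exact: h.
Qed.

Lemma positive_functional_atoms (R : realType) (T : Type) (I : finType)
    (w : I -> R) (z : I -> T) : (forall i, 0 <= w i) ->
  positive_functional (fun g : T -> R => \sum_i w i * g (z i)).
Proof.
move=> w0; split => [f g _ _|a f _|f _ f0].
- by rewrite -big_split; apply: eq_bigr => i _; rewrite mulrDr.
- by rewrite mulr_sumr; apply: eq_bigr => i _; rewrite mulrCA.
- by apply: sumr_ge0 => i _; rewrite mulr_ge0.
Qed.

(** * Discrete Fourier orthogonality *)

Section Trigonometry.
Context {R : realType}.

Lemma sin_add_2pi_nat (x : R) m : sin (x + m%:R * (pi *+ 2)) = sin x.
Proof.
elim: m => [|m IH]; first by rewrite mul0r addr0.
by rewrite -natr1 mulrDl mul1r addrA sinD2pi.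
Qed.

(** With [b = m pi / N], multiplication by [sin (b / 2)] makes the sum telescope, and the two ends
    differ by [m] full turns. The bounds on [m] place [b / 2] strictly between 0 and [pi], so the
    factor is nonzero. *)
Lemma sum_cos_nat N m : (0 < m < N.*2)%N ->
  \sum_(l < N.*2) cos (m%:R * (l%:R * (pi / N%:R))) = 0 :> R.
Proof.
move=> /andP[m0 mN].
have N0 : (0 < N)%N by case: N mN => //; rewrite ltnNge => _.
have N0' : N%:R != 0 :> R by rewrite pnatr_eq0 -lt0n.
pose b : R := m%:R * (pi / N%:R).
have sb : 0 < sin (b / 2).
  apply: sin_gt0_pi; apply/andP; split.
    by rewrite divr_gt0// mulr_gt0// ?ltr0n// divr_gt0// ?pi_gt0// ltr0n.
  have -> : b / 2 = pi * (m%:R / N.*2%:R).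
    by rewrite /b -muln2 natrM; field.
  rewrite -[ltRHS]mulr1 ltr_pM2l ?pi_gt0// ltr_pdivrMr ?mul1r ?ltr_nat//.
  by rewrite ltr0n double_gt0.
apply: (mulfI (lt0r_neq0 sb)); rewrite mulr0 mulr_sumr.
pose G (l : nat) : R := sin (l%:R * b - b / 2) / 2.
rewrite (eq_bigr (fun l : 'I_N.*2 => G l.+1 - G l)); last first.
  move=> l _; rewrite /G.
  have -> : l.+1%:R * b - b / 2 = l%:R * b + b / 2 by rewrite -natr1; field.
  rewrite sinD sinB.
  have -> : m%:R * (l%:R * (pi / N%:R)) = l%:R * b by rewrite /b; ring.
  by field.
rewrite -(big_mkord predT (fun l => G l.+1 - G l)) telescope_sumr//.
rewrite /G mul0r sub0r.
have -> : N.*2%:R * b - b / 2 = - (b / 2) + m%:R * (pi *+ 2).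
  by rewrite /b -muln2 natrM mulr2n; field.
by rewrite sin_add_2pi_nat subrr.
Qed.

Lemma sum_cos_int N (m : int) : (`|m| < N.*2)%N ->
  \sum_(l < N.*2) cos (m%:~R * (l%:R * (pi / N%:R))) = (N.*2)%:R * (m == 0)%:R :> R.
Proof.
move=> mN; have [-> |m0] := eqVneq m 0.
  rewrite mulr1 -[in RHS](card_ord N.*2) -sumr_const.
  by apply: eq_bigr => l _; rewrite mul0r cos0.
rewrite mulr0; apply: etrans (@sum_cos_nat N `|m| _); last by rewrite absz_gt0 m0.
apply: eq_bigr => l _; case: m {mN m0} => m //.
by rewrite NegzE mulrNz mulNr cosN abszN.
Qed.

(** Product-to-sum leaves the frequencies [q - p - n] and [q - p + n]. Both are below [2N] in
    absolute value, which is why [2N] angles are sampled. *)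
Lemma sum_cos_cos N (p q n : nat) : (p < N)%N -> (q < N)%N -> (n < N)%N ->
  \sum_(l < N.*2) cos (q%:R * (l%:R * (pi / N%:R)) - p%:R * (l%:R * (pi / N%:R)))
    * cos (n%:R * (l%:R * (pi / N%:R))) =
  N%:R * ((q == p + n)%N%:R + (p == q + n)%N%:R) :> R.
Proof.
move=> pN qN nN; pose m1 : int := Posz q - Posz p - Posz n.
pose m2 : int := Posz q - Posz p + Posz n.
have -> : (q == p + n)%N = (m1 == 0) by rewrite /m1; lia.
have -> : (p == q + n)%N = (m2 == 0) by rewrite /m2; lia.
apply: (mulfI (_ : 2 != 0 :> R)); first by rewrite pnatr_eq0.
have -> : 2 * (N%:R * ((m1 == 0)%:R + (m2 == 0)%:R)) =
    N.*2%:R * (m1 == 0)%:R + N.*2%:R * (m2 == 0)%:R :> R.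
  by rewrite -muln2 natrM; ring.
rewrite -!sum_cos_int; [|rewrite /m2; lia|rewrite /m1; lia].
rewrite mulr_sumr -big_split; apply: eq_bigr => l _ /=.
have prod x y : 2 * (cos x * cos y) = cos (x - y) + cos (x + y) :> R.
  by rewrite cosB cosD; ring.
rewrite prod /m1 /m2 intrD !intrB -!pmulrn.
by congr (cos _ + cos _); ring.
Qed.

Lemma sum_sin_sin N (p q n : nat) : (p < N)%N -> (q < N)%N -> (n < N)%N ->
  \sum_(l < N.*2) sin (q%:R * (l%:R * (pi / N%:R)) - p%:R * (l%:R * (pi / N%:R)))
    * sin (n%:R * (l%:R * (pi / N%:R))) =
  N%:R * ((q == p + n)%N%:R - (p == q + n)%N%:R) :> R.
Proof.
move=> pN qN nN; pose m1 : int := Posz q - Posz p - Posz n.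
pose m2 : int := Posz q - Posz p + Posz n.
have -> : (q == p + n)%N = (m1 == 0) by rewrite /m1; lia.
have -> : (p == q + n)%N = (m2 == 0) by rewrite /m2; lia.
apply: (mulfI (_ : 2 != 0 :> R)); first by rewrite pnatr_eq0.
have -> : 2 * (N%:R * ((m1 == 0)%:R - (m2 == 0)%:R)) =
    N.*2%:R * (m1 == 0)%:R - N.*2%:R * (m2 == 0)%:R :> R.
  by rewrite -muln2 natrM; ring.
rewrite -!sum_cos_int; [|rewrite /m2; lia|rewrite /m1; lia].
rewrite mulr_sumr -sumrB; apply: eq_bigr => l _ /=.
have prod x y : 2 * (sin x * sin y) = cos (x - y) - cos (x + y) :> R.
  by rewrite cosB cosD; ring.
rewrite prod /m1 /m2 intrD !intrB -!pmulrn.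
by congr (cos _ - cos _); ring.
Qed.

(** Exactly [N - n] pairs of indices below [N] satisfy [q = p + n], one for each [p < N - n]. *)
Lemma sum_diff_eq N n (F : int -> R) : (n < N)%N ->
  \sum_(p < N) \sum_(q < N) (q == p + n :> nat)%N%:R * F (Posz q - Posz p) =
  (N - n)%:R * F (Posz n).
Proof.
move=> nN.
transitivity (\sum_(p < N) (p + n < N)%N%:R * F (Posz n)).
  apply: eq_bigr => p _; have [h|h] := boolP (p + n < N)%N.
    rewrite (bigD1 (Ordinal h))//= eqxx big1 ?addr0; last first.
      move=> q qne; case: eqP => [e|]; last by rewrite mul0r.
      by case/eqP: qne; apply: val_inj.
    by congr (_ * F _); lia.
  rewrite mul0r big1// => q _; case: eqP => [e|]; last by rewrite mul0r.
  by move: h; rewrite -e ltn_ord.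
rewrite -mulr_suml; congr (_ * _).
rewrite -(big_mkord predT (fun p => ((p + n < N)%N%:R : R))).
rewrite (@big_cat_nat _ _ _ (N - n)) ?leq_subr//= [X in _ + X]big1_seq ?addr0; last first.
  move=> p; rewrite mem_index_iota => /and3P[_ h1 h2].
  by rewrite (_ : (p + n < N)%N = false)//; lia.
rewrite (eq_big_nat _ _ (F2 := fun=> 1)) => [|p h]; last first.
  by rewrite (_ : (p + n < N)%N = true)//; lia.
by rewrite sumr_const_nat subn0.
Qed.
End Trigonometry.

(** * Fejer sums of positive definite functions *)

Section FejerKernel.
Context {R : realType}.

(** One point shows that [phi 0] is real. With the points 0 and [n] and weights 1 and [q], the
    choice [q = 1] makes the imaginary parts of [phi n] and [phi (- n)] opposite, and [q = i] makes
    their real parts equal. *)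
Lemma qpos_def_hermitian (phi : int -> quat R) n :
  qpos_def phi -> phi (- n) = qconj (phi n).
Proof.
move=> pd.
have := pd 1%N (fun=> 0) (fun=> qone R).
rewrite /qnonneg_real !(qi_sum, qj_sum, qk_sum) !big_ord1; cbv beta.
rewrite subr0 qmulq1 qconj1 qmul1q => -[z1 [z2 [z3 _]]].
have key q := pd 2%N (fun i => if i == 0 then 0 else n)
  (fun i => if i == 0 then qone R else q).
have [e1 [_ [_ _]]] := key (mkq 0 1 0 0); have [g1 [g2 [g3 _]]] := key (qone R).
move: z1 z2 z3 e1 g1 g2 g3.
rewrite !(qi_sum, qj_sum, qk_sum) !big_ord_recl !big_ord0.
rewrite ?(qi_sum, qj_sum, qk_sum) ?big_ord_recl ?big_ord0 /=.
rewrite !subrr subr0 sub0r.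
case: (phi 0) => [[[a0 a1] a2] a3]; case: (phi n) => [[[b0 b1] b2] b3].
case: (phi (- n)) => [[[c0 c1] c2] c3].
rewrite /qconj /qmul /mkq /qre /qi /qj /qk /= => z1 z2 z3 e1 g1 g2 g3.
by apply: quatP; rewrite /qre /qi /qj /qk /=; lra.
Qed.

(** With [cos] and the real part of [phi] this is the Fejer coefficient [A]; with [sin] and the
    imaginary coordinates it gives the three components of [B]. *)
Definition double_sum (trig : R -> R) (f : int -> R) N (a : R) : R :=
  \sum_(p < N) \sum_(q < N) f (Posz q - Posz p) * trig (q%:R * a - p%:R * a).

(** The test weights are [q_j = s^-j = cos (j a) - sin (j a) u]; only the real part of the resulting
    form is used. *)
Lemma double_sum_ge0 (phi : int -> quat R) N (a u1 u2 u3 : R) : qpos_def phi ->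
  u1 ^+ 2 + u2 ^+ 2 + u3 ^+ 2 = 1 ->
  0 <= double_sum cos (@qre R \o phi) N a
     + double_sum sin (@qi R \o phi) N a * u1
     + double_sum sin (@qj R \o phi) N a * u2
     + double_sum sin (@qk R \o phi) N a * u3.
Proof.
move=> pd u1E.
have [_ [_ [_]]] := pd N (fun i => Posz i) (fun i => mkq (cos (i%:R * a))
  (- sin (i%:R * a) * u1) (- sin (i%:R * a) * u2) (- sin (i%:R * a) * u3)).
rewrite qre_sum /double_sum !mulr_suml -!big_split /=.
congr (_ <= _); apply: eq_bigr => p _.
rewrite qre_sum !mulr_suml -!big_split /=; apply: eq_bigr => q _.
case: (phi _) => [[[x0 x1] x2] x3]; rewrite cosB sinB.
move: (cos (q%:R * a)) (sin (q%:R * a)) (cos (p%:R * a)) (sin (p%:R * a)) => cq sq cp sp.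
rewrite /qconj /qmul /mkq /qre /qi /qj /qk /=.
transitivity (x0 * (cq * cp + sq * sp * (u1 ^+ 2 + u2 ^+ 2 + u3 ^+ 2)) +
  x1 * (sq * cp - cq * sp) * u1 + x2 * (sq * cp - cq * sp) * u2 +
  x3 * (sq * cp - cq * sp) * u3); first by ring.
by rewrite u1E mulr1.
Qed.

(** Orthogonality keeps the pairs with [q - p = n] or [q - p = - n]; evenness of [f] makes the two
    contributions equal. *)
Lemma sum_double_cos (f : int -> R) N n : (n < N)%N -> (forall k, f (- k) = f k) ->
  \sum_(l < N.*2) double_sum cos f N (l%:R * (pi / N%:R))
    * cos (n%:R * (l%:R * (pi / N%:R))) = N.*2%:R * (N - n)%:R * f (Posz n).
Proof.
move=> nN fN.
transitivity (N%:R * (\sum_(p < N) \sum_(q < N)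
   (q == p + n :> nat)%N%:R * f (Posz q - Posz p) +
   \sum_(p < N) \sum_(q < N) (q == p + n :> nat)%N%:R * f (Posz q - Posz p))).
  have E : \sum_(p < N) \sum_(q < N) (q == p + n :> nat)%N%:R * f (Posz q - Posz p) =
      \sum_(p < N) \sum_(q < N) (p == q + n :> nat)%N%:R * f (Posz q - Posz p).
    rewrite exchange_big; apply: eq_bigr => p _; apply: eq_bigr => q _.
    by rewrite -fN opprB.
  rewrite {2}E -big_split mulr_sumr /double_sum.
  under eq_bigr do rewrite mulr_suml.
  rewrite exchange_big; apply: eq_bigr => p _.
  under eq_bigr do rewrite mulr_suml.
  rewrite exchange_big -big_split mulr_sumr; apply: eq_bigr => q _ /=.
  under eq_bigr do rewrite -mulrA.
  by rewrite -mulr_sumr sum_cos_cos//; ring.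
by rewrite sum_diff_eq// -muln2 natrM; ring.
Qed.

(** As for cosines, with oddness of [f] compensating the minus sign in [sum_sin_sin]. *)
Lemma sum_double_sin (f : int -> R) N n : (n < N)%N -> (forall k, f (- k) = - f k) ->
  \sum_(l < N.*2) double_sum sin f N (l%:R * (pi / N%:R))
    * sin (n%:R * (l%:R * (pi / N%:R))) = N.*2%:R * (N - n)%:R * f (Posz n).
Proof.
move=> nN fN.
transitivity (N%:R * (\sum_(p < N) \sum_(q < N)
   (q == p + n :> nat)%N%:R * f (Posz q - Posz p) +
   \sum_(p < N) \sum_(q < N) (q == p + n :> nat)%N%:R * f (Posz q - Posz p))).
  have E : \sum_(p < N) \sum_(q < N) (q == p + n :> nat)%N%:R * f (Posz q - Posz p) =
      \sum_(p < N) \sum_(q < N) (p == q + n :> nat)%N%:R * - f (Posz q - Posz p).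
    rewrite exchange_big; apply: eq_bigr => p _; apply: eq_bigr => q _.
    by rewrite -fN opprB.
  rewrite {2}E -big_split mulr_sumr /double_sum.
  under eq_bigr do rewrite mulr_suml.
  rewrite exchange_big; apply: eq_bigr => p _.
  under eq_bigr do rewrite mulr_suml.
  rewrite exchange_big -big_split mulr_sumr; apply: eq_bigr => q _ /=.
  under eq_bigr do rewrite -mulrA.
  by rewrite -mulr_sumr sum_sin_sin//; ring.
by rewrite sum_diff_eq// -muln2 natrM; ring.
Qed.

(** Taking [u = b / r] and [u = - b / r] with [r = |b|] gives [r <= A]. The masses [(A + r) / 2] and
    [(A - r) / 2] at these two directions then have sum [A] and first moment [b]. *)
Lemma two_atoms (A b1 b2 b3 : R) :
  (forall u1 u2 u3, u1 ^+ 2 + u2 ^+ 2 + u3 ^+ 2 = 1 ->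
     0 <= A + b1 * u1 + b2 * u2 + b3 * u3) ->
  exists y : (R * R * R) * (bool -> R),
    [/\ y.1.1.1 ^+ 2 + y.1.1.2 ^+ 2 + y.1.2 ^+ 2 = 1, forall b, 0 <= y.2 b,
        y.2 true + y.2 false = A &
        [/\ (y.2 true - y.2 false) * y.1.1.1 = b1,
            (y.2 true - y.2 false) * y.1.1.2 = b2 &
            (y.2 true - y.2 false) * y.1.2 = b3]].
Proof.
move=> H; pose r := Num.sqrt (b1 ^+ 2 + b2 ^+ 2 + b3 ^+ 2).
have r2 : r ^+ 2 = b1 ^+ 2 + b2 ^+ 2 + b3 ^+ 2.
  by rewrite sqr_sqrtr// !addr_ge0// sqr_ge0.
(* When [b = 0] any unit vector serves as direction, with mass [A / 2] on each side. *)
have [r0|r0] := eqVneq r 0.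
  have b0 : [/\ b1 = 0, b2 = 0 & b3 = 0].
    move: r2; rewrite r0 expr0n /=.
    move: (sqr_ge0 b1) (sqr_ge0 b2) (sqr_ge0 b3) => h1 h2 h3 h.
    by split; apply/eqP; rewrite -sqrf_eq0; apply/eqP; lra.
  have [-> -> ->] := b0.
  have := H 1 0 0; have [-> -> ->] := b0 => /(_ _) A0.
  have {}A0 : 0 <= A by move: A0; rewrite !mul0r !addr0; apply; ring.
  exists ((1, 0, 0), fun=> A / 2); split => /=; [by ring|by move=> _; lra|by lra|].
  by split; ring.
have H1 := H (b1 / r) (b2 / r) (b3 / r).
have H2 := H (- b1 / r) (- b2 / r) (- b3 / r).
have uE : (b1 / r) ^+ 2 + (b2 / r) ^+ 2 + (b3 / r) ^+ 2 = 1.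
  by rewrite !exprMn -!mulrDl -r2 exprVn divff// expf_neq0.
have br : b1 * (b1 / r) + b2 * (b2 / r) + b3 * (b3 / r) = r.
  by rewrite !mulrA -!mulrDl -!expr2 -r2 expr2 mulfK.
exists ((b1 / r, b2 / r, b3 / r), fun b : bool => (A + (if b then r else - r)) / 2).
split => //=.
- have h1 := H1 uE.
  have h2 : 0 <= A + b1 * (- b1 / r) + b2 * (- b2 / r) + b3 * (- b3 / r).
    by apply: H2; rewrite !mulNr !sqrrN.
  by case; move: h1 h2 br; rewrite !mulNr !mulrN; lra.
- by field.
- by split; field.
Qed.

(** De Moivre's formula: a unit imaginary quaternion squares to -1. *)
Lemma qpown_polar (a u1 u2 u3 : R) n : u1 ^+ 2 + u2 ^+ 2 + u3 ^+ 2 = 1 ->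
  qpown (mkq (cos a) (sin a * u1) (sin a * u2) (sin a * u3)) n =
  mkq (cos (n%:R * a)) (sin (n%:R * a) * u1) (sin (n%:R * a) * u2) (sin (n%:R * a) * u3).
Proof.
move=> uE; elim: n => [|n IH].
  by rewrite mul0r cos0 sin0 !mul0r.
rewrite qpownS IH -natr1 mulrDl mul1r addrC cosD sinD.
move: (cos a) (sin a) (cos (n%:R * a)) (sin (n%:R * a)) => c s cn sn.
apply: quatP; rewrite /qmul /mkq /qre /qi /qj /qk /=; try ring.
transitivity (c * cn - s * sn * (u1 ^+ 2 + u2 ^+ 2 + u3 ^+ 2)); first by ring.
by rewrite uE mulr1.
Qed.

Lemma qsphere_polar (a u1 u2 u3 : R) : u1 ^+ 2 + u2 ^+ 2 + u3 ^+ 2 = 1 ->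
  qsphere (mkq (cos a) (sin a * u1) (sin a * u2) (sin a * u3)).
Proof.
move=> uE; rewrite /qsphere /qnorm2 /mkq /qre /qi /qj /qk /=.
transitivity (cos a ^+ 2 + sin a ^+ 2 * (u1 ^+ 2 + u2 ^+ 2 + u3 ^+ 2)); first by ring.
by rewrite uE mulr1 cos2Dsin2.
Qed.

Lemma fejer_atoms (phi : int -> quat R) N : (0 < N)%N -> qpos_def phi ->
  exists (w : 'I_N.*2 * bool -> R) (x : 'I_N.*2 * bool -> quat R),
  [/\ forall i, 0 <= w i, forall i, qsphere (x i) &
      forall n, (n < N)%N ->
        [/\ \sum_i w i * qre (qpown (x i) n) = (N - n)%:R / N%:R * qre (phi n),
            \sum_i w i * qi (qpown (x i) n) = (N - n)%:R / N%:R * qi (phi n),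
            \sum_i w i * qj (qpown (x i) n) = (N - n)%:R / N%:R * qj (phi n) &
            \sum_i w i * qk (qpown (x i) n) = (N - n)%:R / N%:R * qk (phi n)]].
Proof.
move=> N0 pd; pose a (l : 'I_N.*2) : R := l%:R * (pi / N%:R).
have N0' : N%:R != 0 :> R by rewrite pnatr_eq0 -lt0n.
have H (l : 'I_N.*2) := two_atoms
  (fun u1 u2 u3 => double_sum_ge0 N (a l) pd (u1 := u1) (u2 := u2) (u3 := u3)).
have [y yP] := choice H.
pose sg (b : bool) : R := if b then 1 else -1.
(* Orthogonality yields the factor [2N (N - n)]; this constant turns it into the Fejer weight
   [(N - n) / N]. *)
pose K : R := (N.*2%:R * N%:R)^-1.
have uE l b :
    (sg b * (y l).1.1.1) ^+ 2 + (sg b * (y l).1.1.2) ^+ 2 + (sg b * (y l).1.2) ^+ 2 = 1.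
  have [<- _ _ _] := yP l; rewrite /sg; case: b; ring.
pose x (i : 'I_N.*2 * bool) := mkq (cos (a i.1)) (sin (a i.1) * (sg i.2 * (y i.1).1.1.1))
  (sin (a i.1) * (sg i.2 * (y i.1).1.1.2)) (sin (a i.1) * (sg i.2 * (y i.1).1.2)).
exists (fun i => K * (y i.1).2 i.2), x; split.
- move=> [l b]; have [_ y0 _ _] := yP l.
  by rewrite mulr_ge0// invr_ge0 mulr_ge0.
- by move=> [l b]; apply: qsphere_polar; exact: uE.
move=> n nN.
(* Merge the two atoms at each angle first, then sum over the angles. *)
have fin (F : 'I_N.*2 -> bool -> R) G c :
    (forall l, F l true + F l false = K * G l) -> \sum_l G l = N.*2%:R * (N - n)%:R * c ->
    \sum_i F i.1 i.2 = (N - n)%:R / N%:R * c.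
  move=> FG GE; rewrite -(pair_bigA _ F) /=.
  under eq_bigr do rewrite big_bool /= FG.
  rewrite -mulr_sumr GE /K -muln2 natrM; field.
  by rewrite ?N0' ?pnatr_eq0.
have E l b : qpown (x (l, b)) n = mkq (cos (n%:R * a l))
    (sin (n%:R * a l) * (sg b * (y l).1.1.1)) (sin (n%:R * a l) * (sg b * (y l).1.1.2))
    (sin (n%:R * a l) * (sg b * (y l).1.2)) by exact: qpown_polar (uE l b).
have herm k : phi (- k) = qconj (phi k) by exact: qpos_def_hermitian.
split.
- apply: (fin (fun l b => K * (y l).2 b * qre (qpown (x (l, b)) n))
    (fun l => double_sum cos (@qre R \o phi) N (a l) * cos (n%:R * a l))).
    move=> l; rewrite !E /qre /mkq /=; have [_ _ <- _] := yP l; ring.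
  by apply: (sum_double_cos (f := @qre R \o phi)) => // k; rewrite /= herm.
- apply: (fin (fun l b => K * (y l).2 b * qi (qpown (x (l, b)) n))
    (fun l => double_sum sin (@qi R \o phi) N (a l) * sin (n%:R * a l))).
    move=> l; rewrite !E /qi /mkq /sg /=; have [_ _ _ [<- _ _]] := yP l; ring.
  by apply: (sum_double_sin (f := @qi R \o phi)) => // k; rewrite /= herm.
- apply: (fin (fun l b => K * (y l).2 b * qj (qpown (x (l, b)) n))
    (fun l => double_sum sin (@qj R \o phi) N (a l) * sin (n%:R * a l))).
    move=> l; rewrite !E /qj /mkq /sg /=; have [_ _ _ [_ <- _]] := yP l; ring.
  by apply: (sum_double_sin (f := @qj R \o phi)) => // k; rewrite /= herm.
- apply: (fin (fun l b => K * (y l).2 b * qk (qpown (x (l, b)) n))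
    (fun l => double_sum sin (@qk R \o phi) N (a l) * sin (n%:R * a l))).
    move=> l; rewrite !E /qk /mkq /sg /=; have [_ _ _ [_ _ <-]] := yP l; ring.
  by apply: (sum_double_sin (f := @qk R \o phi)) => // k; rewrite /= herm.
Qed.
End FejerKernel.

(** * Passage to the limit and conclusion *)

Lemma cvg_fejer_weight (R : realType) n (c : R) (u : nat -> R) :
  (forall N, (n < N.+1)%N -> u N = (N.+1 - n)%:R / N.+1%:R * c) ->
  u @ \oo --> c.
Proof.
move=> uE.
have h : (fun N => c - n%:R * c * N.+1%:R^-1) @ \oo --> c.
  rewrite -[X in _ --> X]subr0; apply: cvgB; first exact: cvg_cst.
  by rewrite -[X in _ --> X](mulr0 (n%:R * c)); apply: cvgMr; exact: cvg_harmonic.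
(* The hypothesis on [u] starts at [N = n], so the two sequences are only eventually equal. *)
apply: cvg_trans h; apply: near_eq_cvg; exists n => // N /= nN.
have N0 : N.+1%:R != 0 :> R by rewrite pnatr_eq0.
rewrite uE ?ltnS// natrB; last exact: leqW.
by move: N.+1%:R N0 => x x0; field.
Qed.

(** Each Fejer atom is replaced by a bit stream coding it, which gives a functional for each [N];
    the ultralimit keeps the vanishing property and sends the Fejer weights to 1. *)
Lemma qpos_def_functional (R : realType) (phi : int -> quat R) : qpos_def phi ->
  exists L : ((nat -> bool) -> R) -> R, [/\ positive_functional L,
    forall g, norm_bounded g -> (forall z, @qsphere R (quat_of_bits z) -> g z = 0) ->
      L g = 0 &
    forall n, mkq (L (fun z => qre (qpown (quat_of_bits z) n)))
      (L (fun z => qi (qpown (quat_of_bits z) n)))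
      (L (fun z => qj (qpown (quat_of_bits z) n)))
      (L (fun z => qk (qpown (quat_of_bits z) n))) = phi (Posz n)].
Proof.
move=> pd.
have H N : exists L : ((nat -> bool) -> R) -> R, [/\ positive_functional L,
    forall g, (forall z, @qsphere R (quat_of_bits z) -> g z = 0) -> L g = 0 &
    forall n, (n < N.+1)%N ->
      [/\ L (fun z => qre (qpown (quat_of_bits z) n)) =
            (N.+1 - n)%:R / N.+1%:R * qre (phi n),
          L (fun z => qi (qpown (quat_of_bits z) n)) =
            (N.+1 - n)%:R / N.+1%:R * qi (phi n),
          L (fun z => qj (qpown (quat_of_bits z) n)) =
            (N.+1 - n)%:R / N.+1%:R * qj (phi n) &
          L (fun z => qk (qpown (quat_of_bits z) n)) =
            (N.+1 - n)%:R / N.+1%:R * qk (phi n)]].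
  have [w [x [w0 xS xE]]] := fejer_atoms (ltn0Sn N) pd.
  have [z zE] := choice (fun i => quat_of_bits_surj (xS i)).
  exists (fun g => \sum_i w i * g (z i)); split.
  - exact: positive_functional_atoms.
  - move=> g g0; rewrite big1// => i _; rewrite g0 ?mulr0//.
    by rewrite zE; exact: xS.
  - move=> n nN; have [<- <- <- <-] := xE n nN.
    by split; apply: eq_bigr => i _; rewrite zE.
have [L_ L_P] := choice H.
have posL N : positive_functional (L_ N) by have [] := L_P N.
(* The Fejer weight at [n = 0] is 1, so all the total masses equal [qre (phi 0)]. *)
have L1 N : L_ N (fun=> 1) <= qre (phi 0).
  have [_ _ /(_ 0%N isT)[+ _ _ _]] := L_P N.
  by rewrite subn0 divff ?pnatr_eq0// mul1r => <-.
have [L pL cL] := positive_functional_ultralimit posL L1.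
exists L; split => // [g bg g0|n].
  apply: (cL _ _ bg).
  rewrite (_ : L_ ^~ g = fun=> 0); first exact: cvg_cst.
  by apply/funext => N; have [_ h _] := L_P N; exact: h.
have [c0 c1 c2 c3] := @qcylinder_continuous_pown R n.
have bdd (g : (nat -> bool) -> R) : cylinder_continuous g -> norm_bounded g.
  by move=> /cylinder_continuous_bounded[M _ gM]; exists M.
have lim g c : cylinder_continuous g ->
    (forall N, (n < N.+1)%N -> L_ N g = (N.+1 - n)%:R / N.+1%:R * c) -> L g = c.
  by move=> /bdd bg gE; apply: (cL _ _ bg); exact: cvg_fejer_weight gE.
apply: quatP; apply: lim => // N nN; by have [_ _ /(_ n nN)[]] := L_P N.
Qed.

Unset Implicit Arguments.
Set Strict Implicit.

Theorem mainTheorem9 (R : realType) (phi : int -> quat R) :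
  qpos_def phi <->
  exists mu : {finite_measure set (quat R) -> \bar R},
    mu (~` @qsphere R) = 0%E /\ forall n : int, phi n = qint_pow mu n.
Proof.
split => [pd|[mu [_ phiE]]]; last first.
  by rewrite (_ : phi = qint_pow mu); [exact: qpos_def_int|exact/funext].
have [L [posL suppL LE]] := qpos_def_functional pd.
have [mu [mu0 muE]] := sphere_measure_of_functional posL suppL.
exists mu; split => // n.
have muN k : qint_pow mu (Posz k) = phi (Posz k) by rewrite -LE -muE.
(* The moments of [mu] are positive definite too, so both sides are Hermitian and agreement at
   nonnegative indices extends to all integers. *)
have herm k := qpos_def_hermitian k pd.
case: n => k; first by rewrite muN.
rewrite NegzE herm -muN.
have := qpos_def_hermitian (Posz k.+1) (@qpos_def_int R mu).
by move=> <-.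
Qed.
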